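(* Let $p,q,r\in(0,1)$ with $p+q+r=1$. Let $X_1,\eta_2,\eta_3,\ldots$ be independent random variables, each taking the values $1,-1,0$ with probabilities $p,q,r$ respectively, and let $K_3,K_4,\ldots$ be i.i.d. random variables, uniformly distributed on $\{1,2\}$ and independent of the previous ones. Set $X_2=\eta_2X_1$, $X_{n+1}=\eta_{n+1}X_{K_{n+1}}$ for $n\ge2$, and $S_n=\sum_{k=1}^nX_k$. For $x_1,x_2\in\{-1,0,1\}$ put $\mu(x_1,x_2)=(p-q)(x_1+x_2)/2$ and $\sigma^2(x_1,x_2)=(p+q)(x_1^2+x_2^2)/2-\mu^2(x_1,x_2)$, with $\sigma(x_1,x_2)\ge0$. Then: (a) as $n\to\infty$, $\dfrac{S_n-n(p-q)(X_1+X_2)/2}{\sqrt n}$ converges in distribution to the law with distribution function $F(x)=p(p+q)\Phi(x/\sigma_1)+r(p+q)\Phi(x/\sigma_2)+q(p+q)\Phi(x/\sigma_3)+r\,\mathbf 1\{x\ge0\}$, where $\Phi$ is the standard normal distribution function and $\sigma_1^2=p+q-(p-q)^2$, $\sigma_2^2=\frac{p+q}{2}-\big(\frac{p-q}{2}\big)^2$, $\sigma_3^2=p+q$; (b) $\dfrac{S_n-n(p-q)(X_1+X_2)/2}{n}\to0$ almost surely as $n\to\infty$; (c) for almost all $\omega\in\{X_1^2+X_2^2\neq0\}$, $\limsup_{n\to\infty}\dfrac{S_n-n(p-q)(X_1+X_2)/2}{\sqrt{2n\log\log n}}=\sigma(X_1,X_2)$ and $\liminf_{n\to\infty}\dfrac{S_n-n(p-q)(X_1+X_2)/2}{\sqrt{2n\log\log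 n}}=-\sigma(X_1,X_2)$.
   Context: This is the elephant random walk with delays in which the elephant remembers only the first two steps. The limit in (a) is the mixture $p(p+q)\mathcal N_{0,\sigma_1^2}+r(p+q)\mathcal N_{0,\sigma_2^2}+q(p+q)\mathcal N_{0,\sigma_3^2}+r\delta_0$. *)

(* Defs.v *)
From HB Require Import structures.
From mathcomp Require Import all_boot all_order all_algebra.
From mathcomp Require Import all_classical all_reals all_analysis.
Set Implicit Arguments. Unset Strict Implicit. Unset Printing Implicit Defensive.
Import Order.TTheory GRing.Theory Num.Theory.
Import numFieldNormedType.Exports.
Local Open Scope classical_set_scope.
Local Open Scope ring_scope.

Definition Phi {R : realType} (x : R) : R := fine (normal_prob 0 1 `]-oo, x]).

Definition mutual_indep {d} {T : measurableType d} {R : realType}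
  (P : probability T R) {I : eqType} (F : I -> T -> R) : Prop :=
  (forall i, measurable_fun [set: T] (F i)) /\
  forall (J : seq I) (B : I -> set R), uniq J -> (forall i, measurable (B i)) ->
    P (\bigcap_(i in [set j | j \in J]) (F i @^-1` B i))
    = (\prod_(i <- J) P (F i @^-1` B i))%E.

Definition cvg_in_distribution {d} {T : measurableType d} {R : realType}
  (P : probability T R) (Y : nat -> T -> R) (F : R -> R) : Prop :=
  forall x, {for x, continuous F} ->
    (fun n => fine (P [set w | Y n w <= x])) @ \oo --> F x.

Section erw.
Context {d} {T : measurableType d} {R : realType}.
Variables (X1 : T -> R) (eta K : nat -> T -> R).

(** Steps of the elephant random walk remembering only the first two steps:
    X_1 = X1, X_2 = eta_2 X_1, X_(n+1) = eta_(n+1) X_(K_(n+1)) for n >= 2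
    (K takes values in {1,2}). *)
Definition erw_X (n : nat) (w : T) : R :=
  match n with
  | 0 => 0
  | 1 => X1 w
  | 2 => eta 2 w * X1 w
  | n'.+3 => eta n'.+3 w * (if K n'.+3 w == 1 then X1 w else eta 2 w * X1 w)
  end.

Definition erw_S (n : nat) (w : T) : R := \sum_(1 <= k < n.+1) erw_X k w.

Definition erw_Z (p q : R) (n : nat) (w : T) : R :=
  erw_S n w - n%:R * (p - q) * (X1 w + erw_X 2 w) / 2.
End erw.

Definition erw_mu {R : realType} (p q x1 x2 : R) : R := (p - q) * (x1 + x2) / 2.
Definition erw_sigma {R : realType} (p q x1 x2 : R) : R :=
  Num.sqrt ((p + q) * (x1 ^+ 2 + x2 ^+ 2) / 2 - (erw_mu p q x1 x2) ^+ 2).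

(* Main.v *)
(** Fix the values [x1], [x2] of the first two steps. The later steps are then i.i.d. bounded
    variables with mean [mu (x1, x2)] and variance [sigma (x1, x2) ^ 2], and they are independent
    of [(X_1, X_2)]; so the theorem reduces to the central limit theorem and the law of the
    iterated logarithm for sums of i.i.d. variables that are functions of a letter drawn from a
    finite alphabet, and (b) follows from the law of the iterated logarithm.

    Central limit theorem: the function [u (t, x) = Phi ((a - x) / sqrt t)] solves the heat
    equation, hence replacing one step of the walk by an increment of [t] costs [O(n^(-3/2))].
    After [n] steps [E u (e, S_n / sqrt n)], a smoothed distribution function, is compared with
    [u (e + 1, 0)], and [e] tends to 0.

    Law of the iterated logarithm, upper half: exponential maximal inequality along a geometric
    sequence with ratio close to 1. Lower half: the walk is cut into blocks of [k_j M^j] steps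
    with [k_j] about [ln j / t]; such a block is large as soon as its [k_j] pieces are, and by the
    central limit theorem each piece of [M^j] steps exceeds [a sqrt (2 t M^j)] with probability at
    least [exp (- t)] when [a < sigma] and [t] is large. The block probabilities are therefore of
    order [1 / j], and the blocks are independent. *)
Require Import Defs.
From HB Require Import structures.
From mathcomp Require Import all_boot all_order all_algebra.
From mathcomp Require Import all_classical all_reals all_analysis.
From mathcomp Require Import measurable_realfun ring lra.
Import Order.TTheory GRing.Theory Num.Theory.
Import numFieldNormedType.Exports.
Local Open Scope classical_set_scope.
Local Open Scope ring_scope.

Set Implicit Arguments. Unset Strict Implicit. Unset Printing Implicit Defensive.

(** * Taylor estimates on the unit interval *)

Section taylor.
Context {R : realType}.
Implicit Types (f g : R -> R) (C s : R).

Lemma derive_bounded_le f f1 C :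
  (forall s, 0 <= s <= 1 -> is_derive s 1 f (f1 s)) ->
  (forall s, 0 <= s <= 1 -> `|f1 s| <= C) ->
  forall s, 0 <= s <= 1 -> `|f s - f 0| <= C.
Proof.
move=> df bf s /andP[s0 s1].
have [|||c cs ->] := @MVT_segment R f f1 0 s.
- by [].
- move=> c; rewrite in_itv/= => /andP[c0 cs].
  by apply: df; rewrite ltW//= (le_trans (ltW cs)).
- apply: derivable_within_continuous => c; rewrite in_itv/= => /andP[c0 cs].
  by apply: ex_derive; apply: df; rewrite c0 (le_trans cs).
- rewrite subr0 normrM (ger0_norm s0).
  move: cs; rewrite in_itv/= => /andP[c0 cs].
  have c1 : 0 <= c <= 1 by rewrite c0 (le_trans cs).
  apply: le_trans (bf _ c1).
  by rewrite ler_piMr.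
Qed.

(** Removing the linear part leaves a function with derivative [f1 s - f1 0], again bounded by [C],
    so the mean value bound applies twice. The factor 1/2 of the sharp remainder is given up. *)
Lemma taylor2_le f f1 f2 C :
  (forall s, 0 <= s <= 1 -> is_derive s 1 f (f1 s)) ->
  (forall s, 0 <= s <= 1 -> is_derive s 1 f1 (f2 s)) ->
  (forall s, 0 <= s <= 1 -> `|f2 s| <= C) ->
  `|f 1 - f 0 - f1 0| <= C.
Proof.
move=> d1 d2 b.
have b1 := derive_bounded_le d2 b.
pose g s := f s - f1 0 * s.
have dg s : 0 <= s <= 1 -> is_derive s 1 g (f1 s - f1 0).
  move=> hs; have ? := d1 _ hs.
  have -> : g = f - (f1 0 \*: id) by apply/funext => x.
  by apply: is_derive_eq; rewrite /= [_ *: _]mulr1.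
have h1 : (0 <= (1 : R) <= 1) by rewrite lexx ler01.
have := derive_bounded_le dg b1 h1.
by rewrite /g mulr1 mulr0 subr0 -addrA (addrC (- f1 0)) addrA.
Qed.

Lemma taylor3_le f f1 f2 f3 C :
  (forall s, 0 <= s <= 1 -> is_derive s 1 f (f1 s)) ->
  (forall s, 0 <= s <= 1 -> is_derive s 1 f1 (f2 s)) ->
  (forall s, 0 <= s <= 1 -> is_derive s 1 f2 (f3 s)) ->
  (forall s, 0 <= s <= 1 -> `|f3 s| <= C) ->
  `|f 1 - f 0 - f1 0 - f2 0 / 2| <= C.
Proof.
move=> d1 d2 d3 b.
have b2 := derive_bounded_le d3 b.
pose g s := f s - f2 0 / 2 * s ^+ 2.
pose g1 s := f1 s - f2 0 * s.
have dg s : 0 <= s <= 1 -> is_derive s 1 g (g1 s).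
  move=> hs; have ? := d1 _ hs.
  have -> : g = f - ((f2 0 / 2) \*: (id ^+ 2)) by apply/funext => x.
  apply: is_derive_eq; rewrite /g1 /=; congr (_ - _).
  by rewrite /GRing.scale/= expr1; field.
have dg1 s : 0 <= s <= 1 -> is_derive s 1 g1 (f2 s - f2 0).
  move=> hs; have ? := d2 _ hs.
  have -> : g1 = f1 - (f2 0 \*: id) by apply/funext => x.
  by apply: is_derive_eq; rewrite /= [_ *: _]mulr1.
have := taylor2_le dg dg1 b2.
rewrite /g /g1 expr1n mulr1 expr0n/= !mulr0 !subr0.
by congr (`|_| <= _); ring.
Qed.

End taylor.

(** * The normal distribution function and the heat equation *)

Section gauss.
Context {R : realType}.
Implicit Types x y t b d h s xi e : R.

Let phi : R -> R := normal_pdf 0 1.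

Lemma std_normal_pdfE x : phi x = normal_peak 1 * expR (- x ^+ 2 / 2).
Proof.
by rewrite /phi normal_pdfE ?oner_eq0//= /normal_fun subr0 expr1n.
Qed.

Lemma is_derive_std_normal_pdf x : is_derive x 1 phi (- x * phi x).
Proof.
have -> : phi = normal_peak 1 \*: (expR \o ((- 2^-1) \*: (id ^+ 2))).
  apply/funext => y; rewrite std_normal_pdfE/=; congr (_ * expR _).
  by transitivity (- 2^-1 * y ^+ 2); [field|].
apply: is_derive_eq; rewrite /= /GRing.scale/=.
by rewrite /phi expr1; field.
Qed.

Lemma is_derive_Phi x : is_derive x 1 (@Phi R) (phi x).
Proof.
have intphi : lebesgue_measure.-integrable [set` `]-oo, x + 1]] (EFin \o phi).
  by apply: (integrableS _ _ (subsetT _)) => //; exact: integrable_normal_pdf.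
have xx1 : x < x + 1 by rewrite ltrDl.
have [||d1 d2] := @continuous_FTC1 R phi -oo%O x (x + 1) xx1 intphi.
- by rewrite ltNyr.
- by apply: continuous_normal_pdf; rewrite oner_eq0.
by split => //; rewrite -derive1E.
Qed.

Lemma continuous_Phi : continuous (@Phi R).
Proof.
move=> x; apply/differentiable_continuous/derivable1_diffP.
by have [] := is_derive_Phi x.
Qed.

Lemma std_normal_pdf_gt0 x : 0 < phi x.
Proof. by rewrite std_normal_pdfE mulr_gt0 ?expR_gt0// normal_peak_gt0 ?oner_eq0. Qed.

Lemma PhiB x y : x <= y ->
  exists2 c, x <= c <= y & Phi y - Phi x = phi c * (y - x).
Proof.
move=> xy; have [||c cxy ->] := @MVT_segment R Phi phi x y xy.
- by move=> c _; exact: is_derive_Phi.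
- by apply: continuous_subspaceT => c; exact: continuous_Phi.
- by exists c => //; move: cxy; rewrite in_itv/=.
Qed.

Lemma le_Phi x y : x <= y -> Phi x <= Phi y.
Proof.
move=> xy; rewrite -subr_ge0; have [c _ ->] := PhiB xy.
by rewrite mulr_ge0 ?subr_ge0// ltW// std_normal_pdf_gt0.
Qed.

Lemma Phi_cdf x : (Phi x)%:E = normal_prob 0 1 `]-oo, x].
Proof.
rewrite /Phi fineK//.
by rewrite (@fin_num_measure _ _ _ (normal_prob 0 1 : probability _ R)).
Qed.

Lemma Phi_ge0 x : 0 <= Phi x.
Proof. by rewrite fine_ge0. Qed.

Lemma Phi_le1 x : Phi x <= 1.
Proof.
rewrite -lee_fin Phi_cdf.
exact: (@probability_le1 _ _ _ (normal_prob 0 1 : probability _ R)).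
Qed.

Let idTR : measurableTypeR R -> R := idfun.

#[local] HB.instance Definition _ :=
  @isMeasurableFun.Build _ _ _ _ idTR (@measurable_id _ _ setT).

Lemma Phi_cvgy : Phi x @[x --> +oo] --> (1 : R).
Proof.
have := @cvg_cdfy1 _ _ _ (normal_prob 0 1 : probability _ R)
  (idTR : {RV (normal_prob 0 1 : probability (measurableTypeR R) R) >-> R}).
move=> /fine_cvgP[_]; apply: cvg_trans; apply: near_eq_cvg.
by apply: nearW => x.
Qed.

Lemma Phi_cvgNy : Phi x @[x --> -oo] --> (0 : R).
Proof.
have := @cvg_cdfNy0 _ _ _ (normal_prob 0 1 : probability _ R)
  (idTR : {RV (normal_prob 0 1 : probability (measurableTypeR R) R) >-> R}).
move=> /fine_cvgP[_]; apply: cvg_trans; apply: near_eq_cvg.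
by apply: nearW => x.
Qed.

Lemma Phi_tails e : 0 < e ->
  exists2 y : R, 0 < y & 1 - Phi y < e /\ Phi (- y) < e.
Proof.
move=> e0.
have /cvgrPdist_lt/(_ _ e0) [M1 [_ h1]] := Phi_cvgy.
have /cvgrPdist_lt/(_ _ e0) [M2 [_ h2]] := Phi_cvgNy.
exists (`|M1| + `|M2| + 1).
  by rewrite ltr_wpDl// addr_ge0.
split.
- have := h1 (`|M1| + `|M2| + 1); rewrite /= => h.
  apply: le_lt_trans (h _); first exact: ler_norm.
  by have := ler_norm M1; have := normr_ge0 M2; lra.
- have := h2 (- (`|M1| + `|M2| + 1)); rewrite /= => h.
  rewrite sub0r normrN in h.
  apply: le_lt_trans (h _); first exact: ler_norm.
  have := ler_norm (- M2); rewrite normrN; have := normr_ge0 M1; lra.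
Qed.

(** Mean value theorem on [[y, y + 1]], where the density is smallest at the right end. Against
    [exp (- y ^ 2 / 2)] only a factor of order [exp (- y)] is lost, which [Pw_moderate] can
    afford. *)
Lemma Phi_tail_ge y : 0 <= y -> phi (y + 1) <= 1 - Phi y.
Proof.
move=> y0; apply: (@le_trans _ _ (Phi (y + 1) - Phi y)); last first.
  by rewrite lerB// Phi_le1.
have [|c /andP[yc cy] ->] := @PhiB y (y + 1); first by rewrite lerDl.
rewrite addrAC subrr add0r mulr1 !std_normal_pdfE ler_pM2l ?normal_peak_gt0 ?oner_eq0//.
rewrite ler_expR ler_pM2r ?invr_gt0// lerN2 ler_sqr// nnegrE; lra.
Qed.

(** [psi] and [dpsi] are minus the first and minus the second derivative of the density. *)
Let psi y : R := y * phi y.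
Let dpsi y : R := (1 - y ^+ 2) * phi y.

Let is_derive_psi y : is_derive y 1 psi (dpsi y).
Proof.
have ? := is_derive_std_normal_pdf y.
have -> : psi = id * phi by apply/funext.
by apply: is_derive_eq; rewrite /= /GRing.scale/= /dpsi; ring.
Qed.

(** Gaussian decay beats polynomials: the polynomial factors are at most [4 (1 + y^2)^2], and
    [exp (y^2 / 2)] is the square of [exp (y^2 / 4) >= 1 + y^2 / 4]. The two functions govern the
    third space derivative and the second time derivative of [Phi (b / sqrt t)]. *)
Let poly_pdf_bound : exists2 C : R, 0 < C & forall y,
  `|dpsi y| <= C /\ `|y * dpsi y / 2 + psi y| <= C.
Proof.
have k0 : 0 < normal_peak (1 : R) by rewrite normal_peak_gt0 ?oner_eq0.
exists (normal_peak 1 * 64); first by rewrite mulr_gt0.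
have hb (y P : R) : `|P| <= 4 * (1 + y ^+ 2) ^+ 2 -> `|P * phi y| <= normal_peak 1 * 64.
  move=> hP; rewrite std_normal_pdfE mulrCA normrM (gtr0_norm k0) ler_pM2l//.
  rewrite mulNr expRN normrM normfV (gtr0_norm (expR_gt0 _)).
  rewrite ler_pdivrMr ?expR_gt0//; apply: (le_trans hP).
  have h1 := expR_ge1Dx (y ^+ 2 / 4).
  have -> : y ^+ 2 / 2 = y ^+ 2 / 4 + y ^+ 2 / 4 by field.
  rewrite expRD.
  have s0 := sqr_ge0 y.
  have : (1 + y ^+ 2 / 4) ^+ 2 <= expR (y ^+ 2 / 4) * expR (y ^+ 2 / 4).
    by rewrite -expr2 ler_sqr ?nnegrE ?expR_ge0//; lra.
  nra.
move=> y; have s0 := sqr_ge0 y; split.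
- apply: hb; rewrite ler_norml; nra.
- have -> : y * dpsi y / 2 + psi y = (y * (1 - y ^+ 2) / 2 + y) * phi y.
    by rewrite /dpsi /psi; field.
  apply: hb.
  have hy : `|y| <= 1 + y ^+ 2.
    by rewrite ler_norml; apply/andP; split; nra.
  have -> : y * (1 - y ^+ 2) / 2 + y = y * ((3 - y ^+ 2) / 2) by field.
  rewrite normrM.
  have h2 : `|(3 - y ^+ 2) / 2| <= 4 * (1 + y ^+ 2).
    by rewrite ler_norml; apply/andP; split; lra.
  apply: (le_trans (ler_pM (normr_ge0 _) (normr_ge0 _) hy h2)).
  by rewrite expr2 mulrCA.
Qed.

(** The time derivative of [Phi (b / sqrt t)], equal to half of its second derivative in [b]. *)
Let heat_t t b : R := - psi (b / Num.sqrt t) / (2 * t).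

Let is_derive_scaled b t : 0 < t ->
  is_derive t 1 (fun t => b / Num.sqrt t) (- (b / Num.sqrt t) / (2 * t)).
Proof.
move=> t0; have s0 : 0 < Num.sqrt t by rewrite sqrtr_gt0.
have d1 := is_derive1_sqrt t0.
have d2 := is_deriveV (lt0r_neq0 s0) d1.
have -> : (fun t => b / Num.sqrt t) = b \*: (fun t => (Num.sqrt t)^-1) by [].
apply: is_derive_eq; rewrite /= /GRing.scale/=.
have -> : t = Num.sqrt t ^+ 2 by rewrite sqr_sqrtr// ltW.
rewrite (sqrtr_sqr (Num.sqrt t)) (gtr0_norm s0).
by field; rewrite gt_eqF.
Qed.

(* Both expansions share the coefficient [v] because [(t, x) |-> Phi ((a - x) / sqrt t)]
   solves the heat equation. *)
Lemma Phi_heat_taylor d : 0 < d -> exists2 C : R, 0 < C &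
  forall t b, d <= t -> exists k v : R,
   (forall xi, `|Phi ((b - xi) / Num.sqrt t) - Phi (b / Num.sqrt t) - k * xi - v * xi ^+ 2|
               <= C * `|xi| ^+ 3) /\
   (forall h, 0 <= h ->
     `|Phi (b / Num.sqrt (t + h)) - Phi (b / Num.sqrt t) - v * h| <= C * h ^+ 2).
Proof.
move=> d0; have [C0 C0p hC0] := poly_pdf_bound.
have sd0 : 0 < Num.sqrt d by rewrite sqrtr_gt0.
pose C := C0 / (Num.sqrt d) ^+ 3 + C0 / (2 * d ^+ 2).
exists C; first by rewrite addr_gt0 ?divr_gt0 ?mulr_gt0 ?exprn_gt0.
move=> t b dt; have t0 : 0 < t by exact: lt_le_trans dt.
have s0 : 0 < Num.sqrt t by rewrite sqrtr_gt0.
have tE : t = Num.sqrt t ^+ 2 by rewrite sqr_sqrtr// ltW.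
pose y := b / Num.sqrt t.
(* The first derivative in [xi] at 0, and half of the second one. *)
exists (- phi y / Num.sqrt t), (heat_t t b); split => [xi|h h0].
- pose k := - (xi / Num.sqrt t).
  pose l s := (b - s * xi) / Num.sqrt t.
  have dl s : is_derive s 1 l k.
    have -> : l = cst (b / Num.sqrt t) + (k \*: id).
      apply/funext => x; transitivity (b / Num.sqrt t + k * x) => //.
      by rewrite /l /k; field; rewrite gt_eqF.
    by apply: is_derive_eq; rewrite add0r [_ *: _]mulr1.
  have := @taylor3_le R (Phi \o l) (k \*: (phi \o l)) (- (k ^+ 2) \*: (psi \o l))
    (- (k ^+ 3) \*: (dpsi \o l)) (C * `|xi| ^+ 3).
  rewrite /= /l mul0r subr0 mul1r -/y /GRing.scale/= => H.
  have -> : Phi ((b - xi) / Num.sqrt t) - Phi y - - phi y / Num.sqrt t * xi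
    - heat_t t b * xi ^+ 2 =
    Phi ((b - xi) / Num.sqrt t) - Phi y - k * phi y - - k ^+ 2 * psi y / 2.
    have -> : heat_t t b = - psi y / (2 * Num.sqrt t ^+ 2) by rewrite -tE.
    by rewrite /k; field; rewrite gt_eqF.
  apply: H => s hs.
  + have ? := is_derive_Phi (l s); have ? := dl s.
    by apply: is_derive_eq; rewrite mulrC.
  + have ? := is_derive_std_normal_pdf (l s); have ? := dl s.
    by apply: is_derive_eq; rewrite /= /GRing.scale/= /psi -/(l s); ring.
  + have ? := is_derive_psi (l s); have ? := dl s.
    by apply: is_derive_eq; rewrite /= /GRing.scale/= -/(l s); ring.
  + have [hb _] := hC0 (l s); rewrite normrM normrN normrX normrN.
    rewrite normrM normfV (gtr0_norm s0) exprMn mulrAC -mulrA mulrC -/(l s).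
    rewrite ler_wpM2r ?exprn_ge0// exprVn.
    apply: (@le_trans _ _ (C0 / Num.sqrt d ^+ 3)); last first.
      by rewrite lerDl divr_ge0 ?mulr_ge0 ?exprn_ge0// ltW.
    apply: ler_pM => //.
    by rewrite lef_pV2 ?posrE ?exprn_gt0// lerXn2r ?nnegrE ?sqrtr_ge0// ler_wsqrtr.
- pose l s := t + s * h.
  have dl s : is_derive s 1 l h.
    have -> : l = cst t + (h \*: id).
      by apply/funext => x; rewrite /l mulrC.
    by apply: is_derive_eq; rewrite add0r [_ *: _]mulr1.
  have lp s : 0 <= s <= 1 -> d <= l s.
    by move=> /andP[s00 _]; rewrite /l (le_trans dt)// lerDl mulr_ge0.
  pose Y := fun t => b / Num.sqrt t.
  pose f2 t := (Y t * dpsi (Y t) / 2 + psi (Y t)) / (2 * t ^+ 2).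
  have := @taylor2_le R ((Phi \o Y) \o l) (h \*: ((heat_t^~ b) \o l))
     (h ^+ 2 \*: (f2 \o l)) (C * h ^+ 2).
  rewrite /= /l mul0r addr0 mul1r /GRing.scale/= => H.
  rewrite [heat_t t b * h]mulrC; apply: H => s hs.
  + have ls0 : 0 < l s by exact: lt_le_trans (lp s hs).
    have ? := is_derive_scaled b ls0; have ? := is_derive_Phi (Y (l s)).
    have ? := dl s.
    apply: is_derive_eq; rewrite -/(l s) mulrC; congr (_ * _).
    by rewrite /heat_t /psi -/phi -/(Y (l s)); field; rewrite gt_eqF.
  + have ls0 : 0 < l s by exact: lt_le_trans (lp s hs).
    have d1 : is_derive (l s) 1 (heat_t^~ b) (f2 (l s)).
      have dY : is_derive (l s) 1 Y _ := is_derive_scaled b ls0.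
      have ? := is_derive_psi (Y (l s)).
      have ? : is_derive (l s) 1 (fun t => t^-1) (- (l s) ^- 2 *: 1).
        by apply: (@is_deriveV _ id) => //; rewrite gt_eqF.
      have -> : heat_t^~ b = (- 2^-1) \*: ((psi \o Y) * (fun t => t^-1)).
        apply/funext => x; transitivity (- 2^-1 * (psi (Y x) * x^-1)) => //.
        by rewrite /heat_t invfM; ring.
      apply: is_derive_eq; rewrite /= /GRing.scale/= /f2 -/(Y (l s)).
      by field; rewrite gt_eqF.
    have ? := dl s.
    by apply: is_derive_eq; rewrite /= /GRing.scale/= -/(l s); ring.
  + have [_ hb] := hC0 (Y (l s)).
    rewrite normrM ger0_norm ?exprn_ge0// mulrC ler_wpM2r ?exprn_ge0//.
    have ld := lp s hs; have ls0 : 0 < l s by exact: lt_le_trans ld.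
    apply: (@le_trans _ _ (C0 / (2 * d ^+ 2))); last first.
      by rewrite lerDr divr_ge0 ?exprn_ge0// ltW.
    rewrite /f2 -/(l s) normrM normfV (ger0_norm (_ : 0 <= 2 * l s ^+ 2)); last first.
      by rewrite mulr_ge0 ?exprn_ge0// ltW.
    apply: ler_pM => //; first by rewrite invr_ge0 mulr_ge0 ?exprn_ge0// ltW.
    rewrite lef_pV2 ?posrE ?mulr_gt0 ?exprn_gt0// ler_pM2l// lerXn2r ?nnegrE// ltW//.
Qed.

End gauss.

(** * Expectations over words of independent letters, and the central limit theorem *)

Section words.
Context {R : realType} {L : finType} (wt : L -> R).
Implicit Types (f g : seq L -> R) (s : seq L).

(* [Ew n f] is the expectation of [f (l_1, .., l_n)] for independent letters of law [wt]. *)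
Fixpoint Ew (n : nat) (f : seq L -> R) : R :=
  if n is m.+1 then \sum_l wt l * Ew m (fun s => f (l :: s)) else f [::].

Definition Pw (n : nat) (A : pred (seq L)) : R := Ew n (fun s => (A s)%:R).

Hypothesis wt_ge0 : forall l, 0 <= wt l.
Hypothesis wt_sum1 : \sum_l wt l = 1.

Lemma Ew_eq n f g : (forall s, size s = n -> f s = g s) -> Ew n f = Ew n g.
Proof.
elim: n f g => [|n IH] f g fg /=; first exact: fg.
by apply: eq_bigr => l _; congr (_ * _); apply: IH => s sn; apply: fg => /=; rewrite sn.
Qed.

Lemma Ew_le n f g : (forall s, size s = n -> f s <= g s) -> Ew n f <= Ew n g.
Proof.
elim: n f g => [|n IH] f g fg /=; first exact: fg.
apply: ler_sum => l _; apply: ler_wpM2l => //.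
by apply: IH => s sn; apply: fg => /=; rewrite sn.
Qed.

Lemma Ew_cst n (c : R) : Ew n (fun=> c) = c.
Proof.
elim: n => //= n ->.
by rewrite -mulr_suml wt_sum1 mul1r.
Qed.

Lemma EwD n f g : Ew n (fun s => f s + g s) = Ew n f + Ew n g.
Proof.
elim: n f g => //= n IH f g; rewrite -big_split/=.
by apply: eq_bigr => l _; rewrite IH mulrDr.
Qed.

Lemma EwZ n (c : R) f : Ew n (fun s => c * f s) = c * Ew n f.
Proof.
elim: n f => //= n IH f; rewrite mulr_sumr.
by apply: eq_bigr => l _; rewrite IH mulrCA.
Qed.

(** Fubini: the first [n] letters are independent of the next [m]. Independence of consecutive
    blocks of a word enters in this form. *)
Lemma Ew_cat n m f : Ew (n + m) f = Ew n (fun s => Ew m (fun s' => f (s ++ s'))).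
Proof. by elim: n f => //= n IH f; apply: eq_bigr => l _; rewrite IH. Qed.

Lemma Pw_ge0 n A : 0 <= Pw n A.
Proof. by rewrite -[0](Ew_cst n) Ew_le. Qed.

Lemma Pw_le n (A B : pred (seq L)) :
  (forall s, size s = n -> A s -> B s) -> Pw n A <= Pw n B.
Proof.
move=> AB; apply: Ew_le => s sn; rewrite ler_nat.
by case: (A s) (AB _ sn) => // ->.
Qed.

Lemma PwC n (A : pred (seq L)) : Pw n (predC A) = 1 - Pw n A.
Proof.
apply/eqP; rewrite eq_sym subr_eq -EwD; apply/eqP.
by rewrite -[LHS](Ew_cst n); apply: Ew_eq => s _ /=; case: (A s); rewrite ?addr0 ?add0r.
Qed.

Section sums.
Variable W : L -> R.

Definition Sw s : R := \sum_(l <- s) W l.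

Lemma Sw_cat s s' : Sw (s ++ s') = Sw s + Sw s'.
Proof. by rewrite /Sw big_cat. Qed.

Lemma Sw_cons l s : Sw (l :: s) = W l + Sw s.
Proof. by rewrite /Sw big_cons. Qed.

(** It suffices that each of [k] consecutive pieces of [n] letters has sum at least [y], and the
    pieces are independent. *)
Lemma Pw_mul_le n k (y : R) :
  Pw n (fun s => y <= Sw s) ^+ k <= Pw (k * n) (fun s => k%:R * y <= Sw s).
Proof.
elim: k => [|k IH].
  by rewrite expr0 mul0n /Pw/= /Sw big_nil mul0r lexx.
rewrite mulSn exprS [leRHS]/Pw Ew_cat mulrC.
apply: le_trans (ler_wpM2r (Pw_ge0 _ _) IH) _.
rewrite -EwZ; apply: Ew_le => s _; have [hs|_] := boolP (y <= Sw s); last first.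
  by rewrite mulr0 -/(Pw _ _) Pw_ge0.
rewrite mulr1; apply: Pw_le => s' _ hs'.
by rewrite Sw_cat -natr1 mulrDl mul1r addrC lerD.
Qed.

Hypothesis W_mean : \sum_l wt l * W l = 0.
Variable sigma : R.
Hypothesis sigma_gt0 : 0 < sigma.
Hypothesis W_var : \sum_l wt l * W l ^+ 2 = sigma ^+ 2.

Lemma W_bounded : exists2 B : R, 0 < B & forall l, `|W l| <= B.
Proof.
exists (1 + \sum_l `|W l|); first by rewrite ltr_pwDl// sumr_ge0.
move=> l; rewrite ler_wpDl// (bigD1 l)//= lerDl sumr_ge0//.
Qed.

(** Averaging the space expansion of [Phi_heat_taylor] over one letter kills the linear term, and
    the quadratic term becomes [v / N], exactly the linear term of the time expansion with
    [h = 1 / N]. Remainders of order [N^(-3/2)] and [N^(-2)] are left. *)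
Lemma lindeberg_step (d : R) : 0 < d -> exists2 C : R, 0 < C &
  forall (N : nat) (t b : R), (0 < N)%N -> d <= t ->
  `|\sum_l wt l * Phi ((b - W l / (sigma * Num.sqrt N%:R)) / Num.sqrt t)
    - Phi (b / Num.sqrt (t + N%:R^-1))| <= C / Num.sqrt N%:R ^+ 3.
Proof.
move=> d0; have [C C0 hC] := Phi_heat_taylor d0.
have [B B0 hB] := W_bounded.
exists (C * ((B / sigma) ^+ 3 + 1)).
  by rewrite mulr_gt0// addr_gt0// exprn_gt0// divr_gt0.
move=> N t b N0 dt; have [k [v [h1 h2]]] := hC t b dt.
have sN0 : 1 <= Num.sqrt N%:R :> R by rewrite -[X in X <= _]sqrtr1 ler_wsqrtr// ler1n.
set r := Num.sqrt N%:R in sN0 *.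
have r0 : 0 < r by exact: lt_le_trans sN0.
have rE : N%:R = r ^+ 2 by rewrite sqr_sqrtr.
pose xi l := W l / (sigma * r).
have mxi : \sum_l wt l * xi l = 0.
  by rewrite /xi; under eq_bigr do rewrite mulrA; rewrite -mulr_suml W_mean mul0r.
have vxi : \sum_l wt l * xi l ^+ 2 = N%:R^-1.
  rewrite /xi; under eq_bigr do rewrite exprMn mulrA.
  rewrite -mulr_suml W_var rE exprVn exprMn invfM mulrA divff ?mul1r//.
  by rewrite expf_eq0/= gt_eqF.
pose D l := Phi ((b - xi l) / Num.sqrt t) - Phi (b / Num.sqrt t) - k * xi l - v * xi l ^+ 2.
have -> : \sum_l wt l * Phi ((b - W l / (sigma * r)) / Num.sqrt t)
    - Phi (b / Num.sqrt (t + N%:R^-1)) =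
    \sum_l wt l * D l - (Phi (b / Num.sqrt (t + N%:R^-1)) - Phi (b / Num.sqrt t) - v * N%:R^-1).
  have -> : \sum_l wt l * D l = \sum_l wt l * Phi ((b - W l / (sigma * r)) / Num.sqrt t)
    - (\sum_l wt l) * Phi (b / Num.sqrt t) - k * (\sum_l wt l * xi l)
    - v * (\sum_l wt l * xi l ^+ 2).
    rewrite mulr_suml !mulr_sumr -!sumrB; apply: eq_bigr => l _.
    by rewrite /D /xi; ring.
  by rewrite wt_sum1 mxi vxi; ring.
apply: le_trans (ler_normB _ _) _.
rewrite mulrDr mulr1 mulrDl; apply: lerD.
  apply: le_trans (ler_norm_sum _ _ _) _.
  have -> : C * (B / sigma) ^+ 3 / r ^+ 3 = \sum_l wt l * (C * (B / sigma) ^+ 3 / r ^+ 3).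
    by rewrite -mulr_suml wt_sum1 mul1r.
  apply: ler_sum => l _; rewrite normrM ger0_norm//; apply: ler_wpM2l => //.
  apply: (le_trans (h1 _)); rewrite -mulrA ler_pM2l// -exprVn -exprMn.
  have p0 : 0 <= B / sigma / r by rewrite !divr_ge0// ltW.
  rewrite lerXn2r ?nnegrE//.
  rewrite /xi normrM normfV (gtr0_norm (mulr_gt0 sigma_gt0 r0)) invfM mulrA.
  by rewrite ler_pM2r ?invr_gt0// ler_pM2r ?invr_gt0.
apply: (le_trans (h2 _ _)); first by rewrite invr_ge0.
rewrite ler_pM2l// exprVn rE -exprM lef_pV2 ?posrE ?exprn_gt0//.
by rewrite ler_weXn2l.
Qed.

(** The errors of [lindeberg_step] add up over [N] letters to [N * N^(-3/2)]. The starting time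
    [d > 0] keeps away from the singularity of the heat kernel, so that [C] does not depend on
    [b]. *)
Lemma lindeberg (d : R) : 0 < d -> exists2 C : R, 0 < C &
  forall (N : nat) (b : R), (0 < N)%N ->
  `|Ew N (fun s => Phi ((b - Sw s / (sigma * Num.sqrt N%:R)) / Num.sqrt d))
    - Phi (b / Num.sqrt (d + 1))| <= C / Num.sqrt N%:R.
Proof.
move=> d0; have [C C0 hC] := lindeberg_step d0; exists C => // N b N0.
have sN0 : 0 < Num.sqrt N%:R :> R by rewrite sqrtr_gt0 ltr0n.
set r := Num.sqrt N%:R in sN0 hC *.
have rE : N%:R = r ^+ 2 by rewrite sqr_sqrtr.
(* Generalised to [n] letters at the fixed scale [N], each letter adding [1 / N] to the time. *)
suff H n : `|Ew n (fun s => Phi ((b - Sw s / (sigma * r)) / Num.sqrt d))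
    - Phi (b / Num.sqrt (d + n%:R / N%:R))| <= n%:R * (C / r ^+ 3).
  have := H N; rewrite divff ?pnatr_eq0 -?lt0n// => /le_trans; apply.
  by rewrite rE le_eqVlt; apply/orP; left; apply/eqP; field; rewrite gt_eqF.
elim: n b => [|n IH] b.
  by rewrite /= /Sw big_nil !mul0r addr0 subr0 subrr normr0.
have -> : d + n.+1%:R / N%:R = (d + n%:R / N%:R) + N%:R^-1.
  by rewrite -natr1; field; rewrite pnatr_eq0 -lt0n.
rewrite -natr1 mulrDl mul1r /=.
set t := d + _.
have dt : d <= t by rewrite lerDl divr_ge0.
have -> : Phi (b / Num.sqrt (t + N%:R^-1)) =
  \sum_l wt l * Phi ((b - W l / (sigma * r)) / Num.sqrt t) -
  (\sum_l wt l * Phi ((b - W l / (sigma * r)) / Num.sqrt t) -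
    Phi (b / Num.sqrt (t + N%:R^-1))) by ring.
rewrite opprB addrCA addrC.
apply: le_trans (ler_normD _ _) _; rewrite lerD ?hC//.
rewrite -sumrB; apply: le_trans (ler_norm_sum _ _ _) _.
have -> : n%:R * (C / r ^+ 3) = \sum_l wt l * (n%:R * (C / r ^+ 3)).
  by rewrite -mulr_suml wt_sum1 mul1r.
apply: ler_sum => l _; rewrite -mulrBr normrM ger0_norm// ler_wpM2l//.
have := IH (b - W l / (sigma * r)); congr (`|_ - _| <= _).
by apply: Ew_eq => s _; rewrite Sw_cons (mulrDl (W l)) opprD addrA.
Qed.

Lemma clt (y : R) :
  (fun n => Pw n (fun s => Sw s <= y * Num.sqrt n%:R)) @ \oo --> Phi (y / sigma).
Proof.
wlog -> : / y = (y / sigma) * sigma.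
  by apply; rewrite divfK// gt_eqF.
rewrite mulfK ?gt_eqF//; move: (y / sigma) => {}y.
apply/cvgrPdist_le => e e0.
have e4 : 0 < e / 4 by rewrite divr_gt0.
have /cvgrPdist_lt/(_ _ e4)[rho /= rho0 hrho] := @continuous_Phi R y.
(* Half of the continuity radius pays for shifting the threshold by [eta], the other half for the
   factor [sqrt (r ^ 2 + 1)]. *)
pose eta := rho / 2; have eta0 : 0 < eta by rewrite divr_gt0.
have [y0 y00 [ht1 ht2]] := Phi_tails e4.
(* [D] fixes the width [r = eta / D] of the smoothing: [D >= y0] makes the smoothed indicator
   accurate up to [e / 4] at distance [eta] from its centre, and [D > |y| + eta] makes the extra
   variance [r ^ 2] move the argument by less than [eta]. *)
pose D := y0 + `|y| + eta + 1.
have D0 : 0 < D by rewrite /D; have := normr_ge0 y; lra.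
pose r := eta / D; have r0 : 0 < r by rewrite divr_gt0.
have r_y0 : y0 <= eta / r.
  rewrite /r invfM invrK mulrA divff ?mul1r ?gt_eqF// /D.
  by have := normr_ge0 y; lra.
have rle1 : r <= 1 by rewrite /r ler_pdivrMr// mul1r /D; have := normr_ge0 y; lra.
have d0 : 0 < r ^+ 2 by rewrite exprn_gt0.
have sd : Num.sqrt (r ^+ 2) = r by rewrite sqrtr_sqr gtr0_norm.
have [C C0 hC] := lindeberg d0.
have shift_close z : `|z| <= `|y| + eta ->
    `|z / Num.sqrt (r ^+ 2 + 1) - z| < eta.
  move=> hz.
  have s1 : 1 <= Num.sqrt (r ^+ 2 + 1) by rewrite -[X in X <= _]sqrtr1 ler_wsqrtr// lerDr ltW.
  have s2 : Num.sqrt (r ^+ 2 + 1) <= r ^+ 2 + 1.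
    rewrite -[leRHS]ger0_norm; last by lra.
    rewrite -sqrtr_sqr ler_wsqrtr//; nra.
  set q := Num.sqrt (r ^+ 2 + 1) in s1 s2 *.
  have q0 : 0 < q by lra.
  have -> : z / q - z = - (z * ((q - 1) / q)) by field; rewrite gt_eqF.
  rewrite normrN normrM (ger0_norm (_ : 0 <= (q - 1) / q)); last first.
    by rewrite divr_ge0// ?subr_ge0// ltW.
  have hq : (q - 1) / q <= r.
    rewrite ler_pdivrMr//; nra.
  apply: (@le_lt_trans _ _ ((`|y| + eta) * r)).
    apply: ler_pM => //; rewrite divr_ge0// ?subr_ge0// ltW//.
  rewrite /r mulrA ltr_pdivrMr// mulrC ltr_pM2l// /D; lra.
have close z : `|z - y| <= eta ->
   `|Phi (z / Num.sqrt (r ^+ 2 + 1)) - Phi y| < e / 4.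
  move=> hz; rewrite distrC; apply: hrho => /=.
  have zy : `|z| <= `|y| + eta.
    have -> : z = y + (z - y) by ring.
    by apply: le_trans (ler_normD _ _) _; rewrite lerD2l.
  have -> : y - z / Num.sqrt (r ^+ 2 + 1) =
     - (z - y) - (z / Num.sqrt (r ^+ 2 + 1) - z) by ring.
  apply: le_lt_trans (ler_normB _ _) _; rewrite normrN.
  have -> : rho = eta + eta by rewrite /eta; field.
  by rewrite ler_ltD// shift_close.
have [n0 _ hn0] : \forall n \near \oo, C / Num.sqrt n%:R <= e / 4.
  exists (Num.truncn ((C / (e / 4)) ^+ 2)).+1 => // n /= hn.
  have h : (C / (e / 4)) ^+ 2 <= n%:R.
    apply/ltW; apply: lt_le_trans (truncnS_gt _) _; by rewrite ler_nat.
  have c0 : 0 < C / (e / 4) by rewrite divr_gt0.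
  have sn : C / (e / 4) <= Num.sqrt n%:R.
    by rewrite -[leLHS]gtr0_norm// -sqrtr_sqr ler_wsqrtr.
  by rewrite ler_pdivrMr ?(lt_le_trans c0)// mulrC -ler_pdivrMr.
exists n0.+1 => // n /= nn0.
have n_gt0 : (0 < n)%N by exact: leq_ltn_trans nn0.
have sN0 : 0 < Num.sqrt n%:R :> R by rewrite sqrtr_gt0 ltr0n.
have en : C / Num.sqrt n%:R <= e / 4 by apply: hn0 => /=; exact: ltnW.
set A := fun s => _.
have AE s : A s = (Sw s / (sigma * Num.sqrt n%:R) <= y).
  by rewrite /A ler_pdivrMr ?mulr_gt0// mulrA.
(* Where [A] holds, the indicator smoothed around [y + eta] is at least [Phi y0 > 1 - e / 4]. The
   bound [lo] uses [y - eta] symmetrically. *)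
have up : Pw n A <= Ew n (fun s => Phi ((y + eta - Sw s / (sigma * Num.sqrt n%:R)) / Num.sqrt (r ^+ 2))) + e / 4.
  rewrite -[X in _ <= _ + X](Ew_cst n) -EwD; apply: Ew_le => s _.
  rewrite sd AE; have [hs|_] := boolP (_ <= y); last by rewrite addr_ge0 ?Phi_ge0 // ltW.
  have : Phi y0 <= Phi ((y + eta - Sw s / (sigma * Num.sqrt n%:R)) / r).
    apply: le_Phi; apply: (le_trans r_y0); rewrite ler_pM2r ?invr_gt0//; lra.
  rewrite /=; lra.
have lo : Ew n (fun s => Phi ((y - eta - Sw s / (sigma * Num.sqrt n%:R)) / Num.sqrt (r ^+ 2))) <= Pw n A + e / 4.
  rewrite -[X in _ <= _ + X](Ew_cst n) -EwD; apply: Ew_le => s _.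
  rewrite sd AE; have [hs|] := boolP (_ <= y).
    by apply: (le_trans (Phi_le1 _)); rewrite lerDl ltW.
  rewrite -ltNge => hs; rewrite /= add0r.
  have : Phi ((y - eta - Sw s / (sigma * Num.sqrt n%:R)) / r) <= Phi (- y0).
    apply: le_Phi; rewrite ler_pdivrMr//.
    have : y0 * r <= eta by rewrite -ler_pdivlMr.
    rewrite mulNr; lra.
  lra.
have b1 := hC n (y + eta) n_gt0; have b2 := hC n (y - eta) n_gt0.
have c1 : `|Phi ((y + eta) / Num.sqrt (r ^+ 2 + 1)) - Phi y| < e / 4.
  by apply: close; rewrite addrAC subrr add0r ger0_norm// ltW.
have c2 : `|Phi ((y - eta) / Num.sqrt (r ^+ 2 + 1)) - Phi y| < e / 4.
  by apply: close; rewrite addrAC subrr add0r normrN ger0_norm// ltW.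
move: up lo b1 b2 c1 c2.
rewrite !ler_norml !ltr_norml; lra.
Qed.

End sums.
End words.

(** * Random letters and the law of a word *)

Section letters.
Context {d : measure_display} {T : measurableType d} {R : realType} (P : probability T R).
Context {L : finType}.

Lemma measurable_fin_preimage (X : T -> L) (A : pred L) :
  (forall l, measurable [set w | X w = l]) -> measurable [set w | A (X w)].
Proof.
move=> mX.
suff H (s : seq L) : measurable [set w | X w \in s].
  have -> : [set w | A (X w)] = [set w | X w \in enum A].
    by apply/seteqP; split => w /=; rewrite mem_enum.
  exact: H.
elim: s => [|l s IH].
  by rewrite (_ : [set _ | _] = set0)//; apply/seteqP; split.
have -> : [set w | X w \in l :: s] = [set w | X w = l] `|` [set w | X w \in s].
  apply/seteqP; split => w /=; rewrite in_cons.
  - by move=> /orP[/eqP|]; [left|right].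
  - by move=> [->|->]; rewrite ?eqxx ?orbT.
exact: measurableU.
Qed.

Lemma measure_fin_partition (X : T -> L) (B : set T) :
  (forall l, measurable [set w | X w = l]) -> measurable B ->
  P B = (\sum_l P (B `&` [set w | X w = l]))%E.
Proof.
move=> mX mB.
suff H (s : seq L) : uniq s -> P (B `&` [set w | X w \in s]) =
    (\sum_(l <- s) P (B `&` [set w | X w = l]))%E.
  rewrite -H ?index_enum_uniq//; congr (P _).
  by apply/seteqP; split => w /=; [split=> //; rewrite mem_index_enum|case].
elim: s => [_|l s IH /= /andP[ls us]].
  by rewrite big_nil (_ : _ `&` _ = set0) ?measure0//; apply/seteqP; split => // w [].
rewrite big_cons -IH// -measureU.
- congr (P _); apply/seteqP; split => w /=.
  + by rewrite in_cons => -[Bw /orP[/eqP|]]; [left|right].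
  + by move=> [[Bw ->]|[Bw h]]; rewrite in_cons ?eqxx ?h ?orbT.
- exact: measurableI.
- by apply: measurableI => //; exact: (measurable_fin_preimage (mem s)).
- apply/seteqP; split => // w /= [[_ ->] [_ h]].
  by rewrite h in ls.
Qed.

Variables (wt : L -> R) (X : nat -> T -> L).
Hypothesis mX : forall n l, measurable [set w | X n w = l].

Definition word n w : seq L := mkseq (X ^~ w) n.

Lemma size_word n w : size (word n w) = n.
Proof. exact: size_mkseq. Qed.

Lemma wordS n w : word n.+1 w = rcons (word n w) (X n w).
Proof. by rewrite /word /mkseq -addn1 iotaD map_cat cats1. Qed.

Lemma take_word k n w : (k <= n)%N -> take k (word n w) = word k w.
Proof.
by move=> kn; rewrite /word /mkseq -map_take take_iota (minn_idPl kn).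
Qed.

Lemma measurable_word_eq n s : measurable [set w | word n w = s].
Proof.
elim/last_ind: s n => [|s l IH] [|n].
- by rewrite (_ : [set _ | _] = setT)//; apply/seteqP.
- by rewrite (_ : [set _ | _] = set0)//; apply/seteqP; split.
- rewrite (_ : [set _ | _] = set0)//; apply/seteqP; split => // w /=.
  by move=> /(congr1 size); rewrite size_rcons.
- rewrite (_ : [set _ | _] = [set w | word n w = s] `&` [set w | X n w = l]).
    exact: measurableI.
  apply/seteqP; split => w /=; rewrite wordS.
    by move=> /rcons_inj[].
  by move=> [-> ->].
Qed.

Lemma measurable_word n (A : pred (seq L)) : measurable [set w | A (word n w)].
Proof.
have -> : [set w | A (word n w)] =
    \bigcup_(t in [set t : n.-tuple L | A t]) [set w | word n w = t].
  apply/seteqP; split => w /=.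
    by move=> Aw; exists (Tuple (introT eqP (size_word n w))).
  by move=> [t At /= ->].
apply: fin_bigcup_measurable; first exact: finite_finset.
by move=> t _; exact: measurable_word_eq.
Qed.

Variable E0 : set T.
Hypothesis mE0 : measurable E0.
Hypothesis iidX : forall s : seq L, P (E0 `&` [set w | word (size s) w = s])
  = (P E0 * (\prod_(l <- s) wt l)%:E)%E.

(** [E0] will be an event about the first two steps, so that probabilities of words become [Pw] also
    after conditioning on these steps. *)
Lemma word_law n (A : pred (seq L)) :
  P (E0 `&` [set w | A (word n w)]) = (P E0 * (Pw wt n A)%:E)%E.
Proof.
(* Generalised to a fixed prefix [s]; the induction splits according to the letter that follows
   it. *)
suff H m s : P (E0 `&` [set w | word (size s) w = s] `&` [set w | A (word (size s + m) w)])
    = (P E0 * (\prod_(l <- s) wt l * Pw wt m (fun s' => A (s ++ s')))%:E)%E.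
  have := H n [::]; rewrite big_nil mul1r add0n => <-; congr (P (_ `&` _)).
  by apply/seteqP; split => // w [].
elim: m s => [|m IH] s.
  rewrite addn0 /Pw/= cats0; have [As|As] := boolP (A s).
    rewrite mulr1 -iidX; congr (P _); apply/seteqP; split => w /=; first by case.
    by move=> [? h]; split => //; rewrite h.
  rewrite mulr0 mule0 (_ : _ `&` _ = set0) ?measure0//.
  by apply/seteqP; split => // w /= [[_ ->]]; rewrite (negbTE As).
rewrite (measure_fin_partition (X := X (size s))); [|exact: mX|]; last first.
  apply: measurableI; last exact: measurable_word.
  by apply: measurableI => //; exact: measurable_word_eq.
have PE : P E0 = (fine (P E0))%:E by rewrite fineK// fin_num_measure.
rewrite PE -EFinM /Pw/= !mulr_sumr -sumEFin; apply: eq_bigr => l _.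
have -> : fine (P E0) * (\prod_(k <- s) wt k * (wt l * Ew wt m (fun s' => (A (s ++ l :: s'))%:R)))
  = fine (P E0) * (\prod_(k <- rcons s l) wt k * Pw wt m (fun s' => A (rcons s l ++ s'))).
  rewrite -cats1 big_cat big_seq1/= -mulrA; congr (_ * (_ * (_ * _))).
  by apply: Ew_eq => s' _; rewrite -catA.
rewrite EFinM -PE -IH size_rcons addSnnS; congr (P _); apply/seteqP; split => w /=.
- by move=> [[[? h1] ?] h2]; rewrite wordS h1 h2.
- by rewrite wordS => -[[? /rcons_inj[h1 h2]] ?].
Qed.

End letters.

(** * A bound for the exponential and a convergent series *)

Section exponential_bounds.
Context {R : realType}.

Lemma expR_taylor2 (z : R) : `|z| <= 1 ->
  expR z <= 1 + z + z ^+ 2 / 2 + 4 * `|z| ^+ 3.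
Proof.
move=> z1.
pose l s := s * z.
have dl (s : R) : is_derive s 1 l z.
  have -> : l = z \*: id by apply/funext => x; rewrite /l mulrC.
  by apply: is_derive_eq; rewrite [_ *: _]mulr1.
have := @taylor3_le R (expR \o l) (z \*: (expR \o l)) (z ^+ 2 \*: (expR \o l))
   (z ^+ 3 \*: (expR \o l)) (4 * `|z| ^+ 3).
rewrite /= /l mul0r mul1r expR0 /GRing.scale/= !mulr1 => H.
suff : `|expR z - 1 - z - z ^+ 2 / 2| <= 4 * `|z| ^+ 3.
  by move=> /ler_normlP[_]; lra.
apply: H => s hs; have ? := dl s.
- by apply: is_derive_eq; rewrite mulrC.
- by apply: is_derive_eq; rewrite /= /GRing.scale/=; ring.
- by apply: is_derive_eq; rewrite /= /GRing.scale/=; ring.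
- rewrite normrM normrX mulrC ler_wpM2r ?exprn_ge0//.
  rewrite ger0_norm ?expR_ge0//.
  (* [exp (1/2) <= 2] because [exp (- 1/2) >= 1 - 1/2]; squaring gives 4. *)
  have e3 : expR (1 : R) <= 4.
    have h := expR_ge1Dx (- 2^-1 : R); rewrite expRN in h.
    have -> : expR (1 : R) = expR (2^-1 * 2%:R) by rewrite mulVf// pnatr_eq0.
    rewrite expRM_natr.
    have e0 := expR_gt0 (2^-1 : R); set e := expR _ in h e0 *.
    have : e <= 2 by rewrite -[leLHS]invrK -[leRHS]invrK lef_pV2 ?posrE ?invr_gt0//; lra.
    nra.
  apply: le_trans e3; rewrite ler_expR.
  apply: le_trans (ler_norm _) _; rewrite normrM.
  case/andP: hs => s0 s1; rewrite ger0_norm//.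
  by rewrite -[leRHS]mulr1 ler_pM.
Qed.

(** Integral comparison: by the mean value theorem each term after the first is at most an increment
    of [- x^(-a) / a], and these increments telescope. *)
Lemma powR_series_le (a : R) : 0 < a -> forall n,
  \sum_(i < n) i.+1%:R `^ (- (1 + a)) <= 1 + a^-1.
Proof.
move=> a0 n.
have step i : i.+2%:R `^ (- (1 + a)) <= a^-1 * (i.+1%:R `^ (- a) - i.+2%:R `^ (- a)).
  have [|||c] := @MVT_segment R (fun x => x `^ (- a)) (fun x => - a * x `^ (- a - 1)) i.+1%:R i.+2%:R.
  - by rewrite ler_nat.
  - move=> x; rewrite in_itv/= => /andP[h _].
    by apply: is_derive1_powR; apply: le_lt_trans h.
  - apply: derivable_within_continuous => x; rewrite in_itv/= => /andP[h _].
    by apply: ex_derive; apply: is_derive1_powR; apply: lt_le_trans h.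
  rewrite in_itv/= => /andP[c1 c2] h.
  have c0 : 0 < c by apply: lt_le_trans c1.
  have -> : i.+1%:R `^ (- a) - i.+2%:R `^ (- a) = a * c `^ (- (1 + a)).
    rewrite -opprB h -natr1 addrAC subrr add0r mulr1 mulNr opprK.
    by congr (_ * _ `^ _); ring.
  rewrite mulrA mulVf ?gt_eqF// mul1r !powRN lef_pV2 ?posrE ?powR_gt0//.
  have a1 : 0 <= 1 + a by lra.
  by rewrite ge0_ler_powR// nnegrE// ltW.
case: n => [|n]; first by rewrite big_ord0 addr_ge0// invr_ge0 ltW.
rewrite big_ord_recl powR1 lerD2l.
apply: (@le_trans _ _ (\sum_(i < n) a^-1 * (i.+1%:R `^ (- a) - i.+2%:R `^ (- a)))).
  by apply: ler_sum => i _; exact: step.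
rewrite -mulr_sumr -[leRHS]mulr1 ler_pM2l ?invr_gt0//.
rewrite -(big_mkord xpredT (fun i => i.+1%:R `^ (- a) - i.+2%:R `^ (- a))).
rewrite (eq_bigr (fun i : nat => - (i.+2%:R `^ (- a)) - - (i.+1%:R `^ (- a)))); last first.
  by move=> i _; rewrite opprK addrC.
rewrite (@telescope_sumr _ 0 n (fun i => - (i.+1%:R `^ (- a))))// powR1.
by rewrite opprK addrC gerBl powR_ge0.
Qed.

End exponential_bounds.

(** * Exponential maximal inequality *)

Section maximal.
Context {R : realType} {L : finType} (wt W : L -> R).
Hypothesis wt_ge0 : forall l, 0 <= wt l.
Hypothesis wt_sum1 : \sum_l wt l = 1.
Local Notation Sw := (Sw W).
Local Notation Pw := (Pw wt).

(* Some partial sum of [s], the empty one included, is at least [x]. *)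
Fixpoint hits (x : R) (s : seq L) : bool :=
  (x <= 0) || (if s is l :: s' then hits (x - W l) s' else false).

Lemma hits_take x s k : x <= Sw (take k s) -> hits x s.
Proof.
elim: s x k => [|l s IH] x k /=; first by rewrite /Sw big_nil => ->.
case: k => [|k]; first by rewrite /Sw big_nil => ->.
rewrite Sw_cons => h; apply/orP; right; apply: (IH _ k).
by rewrite lerBlDl.
Qed.

(** Induction on the first letter replaces a stopping time: averaging over a letter produces one
    factor [m]. Since [m >= 1], the bound is at least 1 once the level is reached, whatever number
    of letters remains. *)
Lemma Pw_hits_le lam x n : 0 <= lam -> 1 <= \sum_l wt l * expR (lam * W l) ->
  Pw n (hits x) <= expR (- lam * x) * (\sum_l wt l * expR (lam * W l)) ^+ n.
Proof.
move=> lam0; set m := \sum_l _ => m1.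
have Pw1 k A : Pw k A <= 1.
  by rewrite -[leRHS](Ew_cst wt_sum1 k); apply: Ew_le => // s _; case: (A s).
have trivial_le k y : y <= 0 -> 1 <= expR (- lam * y) * m ^+ k.
  move=> y0; rewrite -[X in X <= _]mulr1; apply: ler_pM => //.
    by rewrite -expR0 ler_expR mulNr -mulrN mulr_ge0// oppr_ge0.
  exact: exprn_ege1.
elim: n x => [|n IH] x; have [x0|x0] := leP x 0.
- exact: le_trans (Pw1 _ _) (trivial_le _ _ x0).
- by rewrite /Pw/= orbF (lt_geF x0) mulr_ge0 ?expR_ge0.
- exact: le_trans (Pw1 _ _) (trivial_le _ _ x0).
- rewrite exprS mulrCA mulr_suml /Pw/=; apply: ler_sum => l _.
  rewrite -mulrA ler_wpM2l// (lt_geF x0)/=.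
  apply: (le_trans (IH _)); rewrite mulrA -expRD ler_wpM2r//.
    by rewrite exprn_ge0// (le_trans _ m1).
  by rewrite ler_expR; lra.
Qed.

Variable sigma : R.
Hypothesis W_mean : \sum_l wt l * W l = 0.
Hypothesis W_var : \sum_l wt l * W l ^+ 2 = sigma ^+ 2.

(** For small [lam] the factor [th > 1] absorbs the cubic term, so the moment generating function of
    a letter is at most that of a centred normal law of variance [th * sigma ^ 2]. *)
Lemma Pw_hits_subgaussian (th : R) : 1 < th -> exists2 l0 : R, 0 < l0 &
  forall lam x n, 0 <= lam <= l0 ->
  Pw n (hits x) <= expR (- lam * x + n%:R * (th * lam ^+ 2 * sigma ^+ 2 / 2)).
Proof.
move=> th1; have [B B0 hB] := W_bounded W.
have th1' : 0 < th - 1 by rewrite subr_gt0.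
(* For [|z| <= z0] the cubic term [4 |z|^3] is at most [(th - 1) z^2 / 2]. *)
pose z0 := (th - 1) / (8 * th).
have th0 : 0 < th by lra.
have z00 : 0 < z0 by rewrite divr_gt0// mulr_gt0.
have z01 : z0 <= 1 by rewrite ler_pdivrMr ?mulr_gt0//; lra.
have z02 : 8 * z0 <= th - 1.
  rewrite /z0 mulrA ler_pdivrMr ?mulr_gt0//; nra.
exists (z0 / B); first by rewrite divr_gt0.
move=> lam x n /andP[lam0 lam1].
have mge : 1 <= \sum_l wt l * expR (lam * W l).
  apply: (@le_trans _ _ (\sum_l wt l * (1 + lam * W l))); last first.
    by apply: ler_sum => l _; rewrite ler_wpM2l// expR_ge1Dx.
  under eq_bigr do rewrite mulrDr mulr1 mulrCA.
  by rewrite big_split/= -mulr_sumr W_mean mulr0 addr0 wt_sum1.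
apply: (le_trans (Pw_hits_le x n lam0 mge)).
rewrite expRD ler_pM2l ?expR_gt0//.
rewrite expRM_natl.
rewrite lerXn2r ?nnegrE ?expR_ge0 ?(le_trans _ mge)//.
apply: le_trans (expR_ge1Dx _).
apply: (@le_trans _ _ (\sum_l wt l * (1 + lam * W l + th * lam ^+ 2 / 2 * W l ^+ 2))).
  apply: ler_sum => l _; rewrite ler_wpM2l//.
  have hz : `|lam * W l| <= z0.
    rewrite normrM ger0_norm//; apply: le_trans (ler_wpM2l lam0 (hB l)) _.
    by rewrite -ler_pdivlMr.
  apply: (le_trans (expR_taylor2 (le_trans hz z01))).
  have -> : th * lam ^+ 2 / 2 * W l ^+ 2 = th * (lam * W l) ^+ 2 / 2 by field.
  set z := lam * W l in hz *.
  have h3 : `|z| ^+ 3 <= z0 * z ^+ 2.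
    by rewrite exprS ler_pM// real_normK// num_real.
  have := sqr_ge0 z; nra.
have -> : \sum_l wt l * (1 + lam * W l + th * lam ^+ 2 / 2 * W l ^+ 2) =
   \sum_l wt l + lam * (\sum_l wt l * W l) + th * lam ^+ 2 / 2 * (\sum_l wt l * W l ^+ 2).
  rewrite !mulr_sumr -!big_split/=; apply: eq_bigr => l _; ring.
rewrite wt_sum1 W_mean W_var mulr0 addr0 lerD2l le_eqVlt; apply/orP; left.
by apply/eqP; ring.
Qed.

End maximal.

(** * Law of the iterated logarithm, upper half *)

Section lil_upper.
Context {d : measure_display} {T : measurableType d} {R : realType} (P : probability T R).
Context {L : finType} (wt : L -> R) (X : nat -> T -> L).
Hypothesis wt_ge0 : forall l, 0 <= wt l.
Hypothesis wt_sum1 : \sum_l wt l = 1.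
Hypothesis mX : forall n l, measurable [set w | X n w = l].
Hypothesis iidX : forall s : seq L, P [set w | word X (size s) w = s]
  = (\prod_(l <- s) wt l)%:E.

Lemma word_prob n (A : pred (seq L)) : P [set w | A (word X n w)] = (Pw wt n A)%:E.
Proof.
have := @word_law _ _ _ P _ wt X mX setT measurableT _ n A.
rewrite setTI probability_setT mul1e; apply => s.
by rewrite setTI mul1e.
Qed.

(** First Borel-Cantelli lemma; a bound on the partial sums of [u] stands for convergence of the
    series. *)
Lemma borel_cantelli_word (N : nat -> nat) (A : nat -> pred (seq L)) (u : nat -> R) (M : R) :
  (forall n, Pw wt (N n) (A n) <= u n) -> (forall n, \sum_(i < n) u i <= M) ->
  {ae P, forall w, exists n, forall j, (n <= j)%N -> ~~ A j (word X (N j) w)}.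
Proof.
move=> hA hu.
pose F j := [set w | A j (word X (N j) w)].
have mF j : measurable (F j) by exact: measurable_word.
exists (lim_sup_set F); split.
- by apply: bigcapT_measurable => n; apply: bigcup_measurable => j _.
- apply: lim_sup_set_cvg0 => //.
  apply: (@le_lt_trans _ _ M%:E); last exact: ltry.
  apply: lime_le; first by apply: is_cvg_nneseries => n _ _.
  apply: nearW => n; rewrite big_mkord.
  apply: (@le_trans _ _ (\sum_(i < n) (u i)%:E)%E); last by rewrite sumEFin lee_fin.
  by apply: lee_sum => i _; rewrite [leLHS]word_prob lee_fin.
- move=> w /= h n _; apply: contrapT => h2; apply: h; exists n => j nj.
  by apply/negP => Aj; apply: h2; exists j.
Qed.

Variables (W : L -> R) (sigma : R).
Hypothesis sigma_gt0 : 0 < sigma.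
Hypothesis W_mean : \sum_l wt l * W l = 0.
Hypothesis W_var : \sum_l wt l * W l ^+ 2 = sigma ^+ 2.

(** By the conventions for root and logarithm outside their domains, this is 0 for [k <= 2]. *)
Definition lil_norm (k : nat) : R := Num.sqrt (2 * k%:R * ln (ln k%:R)).

Lemma lil_norm_ge (u : R) k : 1 <= u -> expR u <= k%:R ->
  Num.sqrt (2 * expR u * ln u) <= lil_norm k.
Proof.
move=> u1 uk; apply: ler_wsqrtr.
have k0 : 0 < k%:R :> R by exact: lt_le_trans (expR_gt0 _) uk.
have ul : u <= ln k%:R by rewrite -[leLHS]expRK ler_ln ?posrE ?expR_gt0.
rewrite ler_pM ?mulr_ge0 ?expR_ge0 ?ln_ge0// ?ler_pM2l//.
by rewrite ler_ln// posrE; lra.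
Qed.

(** The index is the least [j] with [k < exp (a (j + 1))]; minimality gives the left inequality, as
    [0 < J] excludes [j = 0]. *)
Lemma geometric_bracket (a : R) (J : nat) : 0 < a -> (0 < J)%N ->
  exists N, forall k, (N <= k)%N -> exists2 j, (J <= j)%N &
    expR (a * j%:R) <= k%:R < expR (a * j.+1%:R).
Proof.
move=> a0 J0; exists (Num.truncn (expR (a * J%:R))).+1 => k hk.
have Jk : expR (a * J%:R) < k%:R.
  by apply: lt_le_trans (truncnS_gt _) _; rewrite ler_nat.
have ex : exists j, k%:R < expR (a * j.+1%:R).
  exists (Num.truncn (k%:R / a)); apply: lt_le_trans (expR_ge1Dx _).
  rewrite mulrC; apply: (@lt_trans _ _ ((Num.truncn (k%:R / a)).+1%:R * a)); last by rewrite ltrDr.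
  by rewrite -ltr_pdivrMr// truncnS_gt.
case: (ex_minnP ex) => j hj minj.
have Jj : (J <= j)%N.
  rewrite leqNgt; apply/negP => jJ.
  have : expR (a * j.+1%:R) <= expR (a * J%:R) by rewrite ler_expR ler_pM2l// ler_nat.
  by move=> h; have := lt_trans (lt_le_trans hj h) Jk; rewrite ltxx.
exists j => //; rewrite hj andbT leNgt; apply/negP.
case: j hj minj Jj => [|j] hj minj Jj; first by move: (leq_trans J0 Jj).
by move=> /minj; rewrite ltnn.
Qed.

Lemma lil_upper (c : R) : sigma < c ->
  {ae P, forall w, exists N, forall k, (N <= k)%N ->
     Sw W (word X k w) <= c * lil_norm k}.
Proof.
move=> sc; have c0 : 0 < c by exact: lt_trans sc.
(* [th * sigma] is the midpoint of [sigma] and [c]. The same [th] is the ratio of the geometric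
   sequence and the slack in [Pw_hits_subgaussian]; this still leaves the exponent [rho > 1]. *)
pose th := (sigma + c) / (2 * sigma).
have th1 : 1 < th by rewrite ltr_pdivlMr ?mulr_gt0//; lra.
have th0 : 0 < th by lra.
have ths : th * sigma < c.
  by rewrite /th invfM mulrA divfK ?gt_eqF//; lra.
have ths0 : 0 < th * sigma by rewrite mulr_gt0.
pose rho := c ^+ 2 / (th * sigma) ^+ 2.
have rho1 : 1 < rho.
  by rewrite ltr_pdivlMr ?exprn_gt0// mul1r ltr_pXn2r ?nnegrE// ltW.
pose a := ln th.
have a0 : 0 < a by rewrite ln_gt0.
have tha : th = expR a by rewrite lnK// posrE.
have [l0 l00 hl0] := Pw_hits_subgaussian wt_ge0 wt_sum1 W_mean W_var th1.
pose tj j := expR (a * j%:R).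
pose x j := c * Num.sqrt (2 * tj j * ln (a * j%:R)).
pose N j := Num.truncn (tj j.+1).
(* [K] is such that [lam ^ 2 = 2 K ln u / tj j] for the [lam] used below, with [u = a j]. From [j0]
   on this is at most [l0 ^ 2], because [tj j = exp u >= u ^ 2 / 2]. *)
pose K := c ^+ 2 / (th ^+ 2 * sigma ^+ 2) ^+ 2.
have ts0 : 0 < th ^+ 2 * sigma ^+ 2 by rewrite mulr_gt0// ?exprn_gt0.
have K0 : 0 < K by rewrite divr_gt0// ?exprn_gt0.
pose j0 := (Num.truncn ((1 + 4 * K / l0 ^+ 2) / a)).+1.
have hj0 j : (j0 <= j)%N -> 1 + 4 * K / l0 ^+ 2 <= a * j%:R.
  move=> hj; rewrite [leRHS]mulrC -ler_pdivrMr//; apply/ltW.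
  by apply: lt_le_trans (truncnS_gt _) _; rewrite ler_nat.
have bound j : (j0 <= j)%N ->
    Pw wt (N j) (hits W (x j)) <= expR (- rho * ln (a * j%:R)).
  move=> /hj0; set u := a * j%:R => hu.
  have Kl : 0 < 4 * K / l0 ^+ 2 by apply: divr_gt0; [apply: mulr_gt0|apply: exprn_gt0].
  have u1 : 1 <= u by lra.
  have lnu0 : 0 <= ln u by rewrite ln_ge0.
  have t0 : 0 < tj j by exact: expR_gt0.
  pose q := tj j * (th ^+ 2 * sigma ^+ 2).
  have q0 : 0 < q by rewrite mulr_gt0.
  have x0 : 0 <= x j by rewrite mulr_ge0 ?sqrtr_ge0// ltW.
  have x2 : x j ^+ 2 = c ^+ 2 * (2 * tj j * ln u).
    by rewrite exprMn sqr_sqrtr// !mulr_ge0// ltW.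
  (* Minimises [- lam * x j + q * lam ^ 2 / 2]. One factor [th] of [q] comes from
     [Pw_hits_subgaussian], the other from [N j <= tj j * th]. *)
  pose lam := x j / q.
  have lam0 : 0 <= lam by rewrite divr_ge0// ltW.
  have lam1 : lam <= l0.
    rewrite -ler_sqr ?nnegrE ?(ltW l00)// /lam exprMn exprVn ler_pdivrMr ?exprn_gt0//.
    have tju : u ^+ 2 / 2 <= tj j.
      have := expR_ge1Dxn 1 (le_trans ler01 u1).
      by rewrite -/(tj j) (_ : 2`! = 2)%N//; lra.
    have lnu : ln u <= u by apply/ltW/ln_sublinear; lra.
    have h1 : 4 * K <= l0 ^+ 2 * u.
      have : 4 * K / l0 ^+ 2 <= u by lra.
      by rewrite ler_pdivrMr ?exprn_gt0// [leRHS]mulrC.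
    have h2 : 2 * K * ln u <= l0 ^+ 2 * tj j.
      have l2 : 0 < l0 ^+ 2 by rewrite exprn_gt0.
      apply: (@le_trans _ _ (l0 ^+ 2 * (u ^+ 2 / 2))); last by rewrite ler_pM2l.
      apply: (@le_trans _ _ (2 * K * u)); first by rewrite ler_pM2l// mulr_gt0.
      nra.
    have -> : x j ^+ 2 = 2 * K * ln u * (tj j * (th ^+ 2 * sigma ^+ 2) ^+ 2).
      rewrite x2 /K; field.
      by rewrite !gt_eqF.
    have -> : l0 ^+ 2 * q ^+ 2 = l0 ^+ 2 * tj j * (tj j * (th ^+ 2 * sigma ^+ 2) ^+ 2).
      by rewrite /q; ring.
    by rewrite ler_wpM2r// mulr_ge0 ?sqr_ge0// ltW.
  have lamb : 0 <= lam <= l0 by rewrite lam0.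
  apply: (le_trans (hl0 lam (x j) (N j) lamb)); rewrite ler_expR.
  have hN : (N j)%:R <= tj j * th.
    rewrite tha -expRD -[X in _ + X]mulr1 -mulrDr natr1.
    by rewrite truncn_le expR_ge0.
  apply: (@le_trans _ _ (- lam * x j + tj j * th * (th * lam ^+ 2 * sigma ^+ 2 / 2))).
    rewrite lerD2l ler_wpM2r// mulr_ge0// mulr_ge0 ?sqr_ge0// mulr_ge0 ?sqr_ge0// ltW//.
  have -> : - lam * x j + tj j * th * (th * lam ^+ 2 * sigma ^+ 2 / 2) = - (x j ^+ 2 / (2 * q)).
    have -> : tj j * th * (th * lam ^+ 2 * sigma ^+ 2 / 2) = q * lam ^+ 2 / 2.
      by rewrite /q; ring.
    by rewrite /lam; field; rewrite gt_eqF.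
  rewrite x2 /q /rho le_eqVlt; apply/orP; left; apply/eqP; field.
  by rewrite !gt_eqF.
have del0 : 0 < rho - 1 by rewrite subr_gt0.
have rhoE : rho = 1 + (rho - 1) by ring.
(* Indices are shifted by [j0 + 1], since [bound] holds from [j0] on and the comparison series
   starts at 1. *)
have := @borel_cantelli_word (fun i => N (i.+1 + j0)%N) (fun i => hits W (x (i.+1 + j0)%N))
  (fun i => expR (- rho * ln a) * i.+1%:R `^ (- (1 + (rho - 1))))
  (expR (- rho * ln a) * (1 + (rho - 1)^-1)).
have h1 n : Pw wt (N (n.+1 + j0)%N) (hits W (x (n.+1 + j0)%N))
    <= expR (- rho * ln a) * n.+1%:R `^ (- (1 + (rho - 1))).
  apply: (le_trans (bound _ _)); first by rewrite leq_addl.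
  rewrite -rhoE /powR pnatr_eq0/= -expRD -mulrDr ler_expR.
  rewrite !mulNr lerN2 ler_pM2l; last by lra.
  rewrite -lnM ?posrE// ler_ln ?posrE ?mulr_gt0// ?ltr0n ?addSn// ler_pM2l//.
  by rewrite ler_nat -addSn leq_addr.
have h2 n : \sum_(i < n) expR (- rho * ln a) * i.+1%:R `^ (- (1 + (rho - 1)))
    <= expR (- rho * ln a) * (1 + (rho - 1)^-1).
  by rewrite -mulr_sumr ler_pM2l ?expR_gt0// powR_series_le.
move=> /(_ h1 h2); apply: filterS => w [n hn].
have J0 : (0 < n.+1 + j0)%N by [].
have [N0 hN0] := geometric_bracket a0 J0.
exists N0 => k /hN0[j Jj /andP[tk kt]].
have j0j : (j0.+1 <= j)%N by apply: leq_trans Jj; rewrite addSnnS leq_addl.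
have jE : ((j - j0.+1).+1 + j0 = j)%N by rewrite addSnnS subnK.
have nj : (n <= j - j0.+1)%N by rewrite leq_subRL// addnC -addSnnS.
have := hn _ nj; rewrite jE => nh.
rewrite leNgt; apply/negP => lt; case/negP: nh.
(* The prefix of length [k] lies within the first [N j] letters, and [x j <= c * lil_norm k] since
   [k >= tj j]; an excess at time [k] would therefore be a hit of level [x j]. *)
have kN : (k <= N j)%N by rewrite truncn_ge_nat ?expR_ge0// ltW.
apply: (@hits_take _ _ _ _ _ k); rewrite take_word//.
apply: le_trans (ltW lt); rewrite ler_pM2l// lil_norm_ge//.
have Kl : 0 < 4 * K / l0 ^+ 2 by apply: divr_gt0; [apply: mulr_gt0|apply: exprn_gt0].
have : (j0 <= j)%N by apply: leq_trans Jj; exact: leq_addl.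
by move=> /hj0; lra.
Qed.

End lil_upper.

(** * Law of the iterated logarithm, lower half *)

Section lil_lower.
Context {d : measure_display} {T : measurableType d} {R : realType} (P : probability T R).
Context {L : finType} (wt : L -> R) (X : nat -> T -> L).
Hypothesis wt_ge0 : forall l, 0 <= wt l.
Hypothesis wt_sum1 : \sum_l wt l = 1.
Hypothesis mX : forall n l, measurable [set w | X n w = l].
Hypothesis iidX : forall s : seq L, P [set w | word X (size s) w = s]
  = (\prod_(l <- s) wt l)%:E.
Variables (W : L -> R) (sigma : R).
Hypothesis sigma_gt0 : 0 < sigma.
Hypothesis W_mean : \sum_l wt l * W l = 0.
Hypothesis W_var : \sum_l wt l * W l ^+ 2 = sigma ^+ 2.
Local Notation Sw := (Sw W).
Local Notation word := (word X).

Section blocks.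
Variables (len : nat -> nat) (y : nat -> R).

Let pos j : nat := (\sum_(i < j) len i)%N.

Let posS j : pos j.+1 = (pos j + len j)%N.
Proof. by rewrite /pos big_ord_recr. Qed.

Let le_pos i j : (i <= j)%N -> (pos i <= pos j)%N.
Proof.
elim: j => [|j IH]; first by rewrite leqn0 => /eqP ->.
rewrite leq_eqVlt => /orP[/eqP->//|ij].
by rewrite posS (leq_trans (IH _))// leq_addr.
Qed.

Let fails J m (s : seq L) :=
  all (fun j => Sw (take (pos j.+1) s) - Sw (take (pos j) s) < y j) (iota J m).

(** The last block is independent of the preceding ones, and [1 - u <= exp (- u)] turns the product
    of failure probabilities into the exponential of a sum. *)
Let Pw_fails (u : nat -> R) J m :
  (forall j, (J <= j)%N -> u j <= Pw wt (len j) (fun s => y j <= Sw s)) ->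
  Pw wt (pos (J + m)) (fails J m) <= expR (- \sum_(i < m) u (J + i)%N).
Proof.
move=> hu; elim: m => [|m IH].
  by rewrite big_ord0 oppr0 expR0 /fails/= /Pw Ew_cst.
rewrite big_ord_recr/= opprD expRD addnS posS /Pw Ew_cat.
have h1 : 1 - Pw wt (len (J + m)%N) (fun s => y (J + m)%N <= Sw s) <= expR (- u (J + m)%N).
  apply: le_trans (expR_ge1Dx _).
  by rewrite lerD2l lerN2 hu// leq_addr.
have p0 : 0 <= 1 - Pw wt (len (J + m)%N) (fun s => y (J + m)%N <= Sw s).
  by rewrite -PwC// Pw_ge0.
rewrite mulrC; apply: le_trans (ler_pM p0 (Pw_ge0 wt_ge0 wt_sum1 _ _) h1 IH).
rewrite -EwZ; apply: Ew_le => // s ss.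
rewrite mulrC; have [fs|fs] := boolP (fails J m s); last first.
  rewrite mul0r -[leRHS](Ew_cst wt_sum1 (len (J + m)%N)); apply: Ew_le => // s' ss'.
  rewrite lern0 eqb0; apply: contra fs; rewrite /fails -addn1 iotaD all_cat => /andP[h _].
  apply/allP => j hj; have := allP h _ hj.
  move: hj; rewrite mem_iota => /andP[_ hj].
  by rewrite !takel_cat// ss le_pos// ltnW.
rewrite mul1r -PwC//; apply: Pw_le => // s' ss' /=.
rewrite /fails -addn1 iotaD all_cat/= andbT => /andP[_].
rewrite (take_size_cat (n := pos (J + m)))// take_oversize; last first.
  by rewrite size_cat ss ss' posS.
by rewrite Sw_cat addrAC subrr add0r ltNge.
Qed.

(** Second Borel-Cantelli lemma for disjoint blocks: by [Pw_fails], failure of all blocks from some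
    index on has probability below every [e > 0]. *)
Lemma borel_cantelli2_blocks (u : nat -> R) j0 :
  (forall j, (j0 <= j)%N -> u j <= Pw wt (len j) (fun s => y j <= Sw s)) ->
  (forall J M, exists m, M <= \sum_(i < m) u (J + i)%N) ->
  {ae P, forall w, forall J, exists2 j, (J <= j)%N &
    y j <= Sw (word (\sum_(i < j.+1) len i)%N w) - Sw (word (\sum_(i < j) len i)%N w)}.
Proof.
move=> hu du; apply: ae_foralln => J; pose J' := (J + j0)%N.
pose B m := [set w | fails J' m (word (pos (J' + m)) w)].
have mB m : measurable (B m) by exact: measurable_word.
exists (\bigcap_m B m); split.
- exact: bigcapT_measurable.
- apply/eqP; rewrite eq_le measure_ge0 andbT; apply/lee_addgt0Pr => e e0.
  rewrite add0e; have [m hm] := du J' (- ln e).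
  apply: (@le_trans _ _ (P (B m))).
    by apply: le_measure; rewrite ?inE//; [exact: bigcapT_measurable|exact: bigcap_inf].
  rewrite [leLHS](word_prob mX iidX) lee_fin.
  apply: (le_trans (@Pw_fails u J' m _)).
    by move=> j hj; apply: hu; apply: leq_trans hj; exact: leq_addl.
  by rewrite -[leRHS]lnK ?posrE// ler_expR lerNl.
- move=> w /= h m _; apply/allP => j; rewrite mem_iota => /andP[Jj jm].
  rewrite !take_word ?le_pos//; last exact: ltnW.
  rewrite ltNge; apply/negP => hj; apply: h; exists j => //.
  by apply: leq_trans Jj; exact: leq_addr.
Qed.

End blocks.

(** Central limit theorem at the threshold [z * sigma], with [t] defined by
    [a * sqrt (2 t) = z * sigma]. As [a < sigma], [exp (- t)] decays in [z] faster than the normal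
    tail at [z], so a large [z] works. *)
Lemma Pw_moderate (a : R) : 0 < a < sigma -> exists t b0, 0 < t /\
  forall b, (b0 <= b)%N ->
    expR (- t) <= Pw wt b (fun s => a * Num.sqrt (2 * t) * Num.sqrt b%:R <= Sw s).
Proof.
move=> /andP[a0 asig].
pose be : R := (sigma / a) ^+ 2 - 1.
have be0 : 0 < be by rewrite subr_gt0 exprn_egt1// ltr_pdivlMr// mul1r.
have pk0 : 0 < normal_peak (1 : R) by rewrite normal_peak_gt0 ?oner_eq0.
pose K : R := `|ln (normal_peak (1 : R))|.
have K0 : 0 <= K by exact: normr_ge0.
(* Large enough that [be * z ^ 2 / 2] exceeds [z + 1/2 + K], the loss from evaluating the density at
   [z + 1] and from its normalising constant. *)
pose z : R := (4 + 2 * K) / be + 1.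
have bez : be * z = 4 + 2 * K + be by rewrite /z; field; rewrite gt_eqF.
have z1 : 1 <= z by rewrite lerDr divr_ge0// ?(ltW be0)//; lra.
have z0 : 0 < z by lra.
pose t : R := (z * sigma) ^+ 2 / (2 * a ^+ 2).
have t0 : 0 < t by rewrite divr_gt0 ?mulr_gt0 ?exprn_gt0 ?mulr_gt0.
have yE : a * Num.sqrt (2 * t) = z * sigma.
  have -> : 2 * t = (z * sigma / a) ^+ 2 by rewrite /t; field; rewrite gt_eqF.
  rewrite sqrtr_sqr gtr0_norm ?divr_gt0 ?mulr_gt0//.
  by rewrite mulrC divfK// gt_eqF.
have tail : expR (- t) < 1 - Phi (z * sigma / sigma).
  rewrite mulfK ?gt_eqF//; apply: lt_le_trans (Phi_tail_ge (ltW z0)).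
  rewrite std_normal_pdfE -[X in _ < X * _]lnK ?posrE// -expRD ltr_expR.
  have -> : t = z * (be * z) / 2 + z ^+ 2 / 2 by rewrite /t /be; field; rewrite gt_eqF.
  rewrite bez.
  have : - K <= ln (normal_peak (1 : R)) by rewrite lerNl ler_normr lexx orbT.
  nra.
have := clt wt_ge0 wt_sum1 W_mean sigma_gt0 W_var (y := z * sigma).
move=> /cvgrPdist_lt/(_ (1 - Phi (z * sigma / sigma) - expR (- t))).
rewrite subr_gt0 => /(_ tail)[b0 _ hb0].
exists t, b0; split => // b hb.
have := hb0 b hb => /=; rewrite yE => h.
set A := fun s => _ in h.
have h2 : 1 - Pw wt b A <= Pw wt b (fun s => z * sigma * Num.sqrt b%:R <= Sw s).
  rewrite -PwC//; apply: Pw_le => // s _ /=; rewrite -ltNge; exact: ltW.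
apply: le_trans h2; move: h; rewrite ltr_norml => /andP[+ _]; lra.
Qed.

Lemma lil_norm_le (v : R) k : k%:R <= expR v -> 1 <= v ->
  lil_norm k <= Num.sqrt (2 * k%:R * ln v) :> R.
Proof.
move=> kv v1; apply: ler_wsqrtr; rewrite ler_wpM2l ?mulr_ge0//.
(* If [ln k <= 0], the outer logarithm has its default value 0. *)
have [lk|lk] := leP (ln k%:R : R) 0; first by rewrite ln0// ln_ge0.
have k0 : 0 < k%:R :> R.
  by rewrite ltNge; apply/negP => h; rewrite ln0// ltxx in lk.
rewrite ler_ln ?posrE//; last by lra.
by rewrite -[leRHS]expRK ler_ln ?posrE ?expR_gt0.
Qed.

Lemma harmonic_diverges (c : R) J M : 0 < c ->
  exists m, M <= \sum_(i < m) c * (J + i).+1%:R^-1.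
Proof.
move=> c0; apply: contrapT => h.
apply: (@dvg_harmonic R); apply: nondecreasing_is_cvgn.
  apply/nondecreasing_seqP => n; rewrite /series/= big_nat_recr//= lerDl.
  exact: harmonic_ge0.
exists (M / c + \sum_(i < J) i.+1%:R^-1) => _ [n _ <-].
apply: (@le_trans _ _ (series harmonic (J + n))).
  rewrite /series/= [leRHS](big_cat_nat _ (n := n))//= ?leq_addl//.
  by rewrite lerDl sumr_ge0// => i _; exact: harmonic_ge0.
rewrite /series/= (big_cat_nat _ (n := J))//= ?leq_addr// addrC lerD//; last first.
  by rewrite big_mkord.
rewrite ler_pdivlMr// mulrC mulr_sumr -{1}[J]add0n big_addn addKn big_mkord.
apply/ltW; rewrite ltNge; apply/negP => hM; apply: h; exists n.
by apply: (le_trans hM); rewrite le_eqVlt; apply/orP; left; apply/eqP/eq_bigr => i _; rewrite addnC.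
Qed.

(** The norm is taken at [k.+2] because a word of [k] letters drives the walk up to step [k + 2]. *)
Lemma lil_lower (a : R) : 0 < a < sigma ->
  {ae P, forall w, forall N, exists2 k, (N <= k)%N & a * lil_norm k.+2 <= Sw (word k w)}.
Proof.
move=> /andP[a0 asig].
(* The gap [a' - a] pays for the walk being negative before the block and for the norm at its end
   exceeding that of the block alone. *)
pose a' : R := (a + sigma) / 2.
have a'b : 0 < a' < sigma by apply/andP; split; rewrite /a'; lra.
have aa' : 0 < a' - a by rewrite /a'; lra.
have [t [b0 [t0 hb0]]] := Pw_moderate a'b.
(* Makes [(a + 2 sigma) / r <= a' - a], which concludes the proof. The ratio [M = 2 r ^ 2 + 1] makes
   the past at most the fraction [1 / (2 r ^ 2)] of the block. *)
pose r := (Num.truncn ((a + 2 * sigma) / (a' - a))).+1.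
have r1 : 1 <= r%:R :> R by rewrite ler1n.
have r0 : 0 < r%:R :> R by rewrite ltr0n.
have hr : a + 2 * sigma <= r%:R * (a' - a).
  by rewrite -ler_pdivrMr// ltW// truncnS_gt.
pose m := (2 * r ^ 2)%N.
have m0 : (0 < m)%N by rewrite muln_gt0 expn_gt0.
have mE : m%:R = 2 * r%:R ^+ 2 :> R by rewrite natrM natrX.
pose M := m.+1.
(* Since [t * k j <= ln j + t], a block of [k j] pieces succeeds with probability at least
   [exp (- t) / j]; since [t * k j >= ln j], its height [y j] is at least
   [a' * sqrt (2 * len j * ln j)]. *)
pose k j := (Num.truncn (ln j%:R / t : R)).+1.
pose len j := (k j * M ^ j)%N.
pose pos j := (\sum_(i < j) len i)%N.
pose y j : R := (k j)%:R * (a' * Num.sqrt (2 * t) * Num.sqrt (M ^ j)%:R).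
have ln_nat_homo i j : (i <= j)%N -> ln i%:R <= ln j%:R :> R.
  case: i => [|i] ij; last by rewrite ler_ln ?posrE ?ltr0n ?(leq_trans _ ij)// ler_nat.
  rewrite ln0//; case: j ij => [|j] _; [by rewrite ln0|by rewrite ln_ge0// ler1n].
have lnj0 j : 0 <= ln j%:R :> R by rewrite -[X in X <= _](@ln0 R 0)// (ln_nat_homo 0).
have k_homo i j : (i <= j)%N -> (k i <= k j)%N.
  by move=> ij; rewrite ltnS le_truncn// ler_pM2r ?invr_gt0// ln_nat_homo.
have k_ge j : ln j%:R <= t * (k j)%:R.
  by rewrite mulrC -ler_pdivrMr// ltW// truncnS_gt.
have k_le j : t * (k j)%:R <= ln j%:R + t.
  rewrite /k -natr1 mulrDr mulr1 lerD2r mulrC -ler_pdivlMr//.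
  by rewrite truncn_le divr_ge0// ltW.
have M_gt j : (j < M ^ j)%N by rewrite ltn_expl.
have len_gt j : (j < len j)%N by apply: (leq_trans (M_gt j)); rewrite leq_pmull.
have pos_ge j : (j <= pos j)%N.
  elim: j => // j IH; rewrite /pos big_ord_recr/= -addn1 leq_add//.
  exact: leq_ltn_trans (len_gt j).
have pos_le j : (pos j * m <= len j)%N.
  elim: j => [|j IH]; first by rewrite /pos big_ord0.
  rewrite /pos big_ord_recr/= mulnDl -/(pos j).
  apply: (@leq_trans (len j * M)); first by rewrite /M mulnS leq_add2r.
  by rewrite /len -mulnA -expnSr leq_pmul2r ?k_homo// expn_gt0.
have block_prob j : (b0.+1 <= j)%N ->
    expR (- t) * j.+1%:R^-1 <= Pw wt (len j) (fun s => y j <= Sw s).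
  move=> hj; have b0M : (b0 <= M ^ j)%N by apply: ltnW; exact: ltn_trans hj (M_gt j).
  apply: le_trans (Pw_mul_le wt_ge0 wt_sum1 W (M ^ j) (k j) _).
  apply: (@le_trans _ _ (expR (- t) ^+ k j)); last first.
    by rewrite lerXn2r ?nnegrE ?expR_ge0 ?Pw_ge0// hb0.
  have j0 : 0 < j%:R :> R by rewrite ltr0n (leq_trans _ hj).
  rewrite -expRM_natr mulNr.
  apply: (@le_trans _ _ (expR (- (ln j%:R + t)))); last by rewrite ler_expR lerN2 k_le.
  rewrite opprD expRD mulrC ler_pM2r ?expR_gt0// expRN lnK ?posrE//.
  by rewrite lef_pV2 ?posrE// ler_nat.
have := borel_cantelli2_blocks block_prob
  (fun J M => harmonic_diverges J M (expR_gt0 (- t))).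
have sigma2 : sigma < 2 * sigma by lra.
have W_mean' : \sum_l wt l * - W l = 0.
  by under eq_bigr do rewrite mulrN; rewrite sumrN W_mean oppr0.
have W_var' : \sum_l wt l * (- W l) ^+ 2 = sigma ^+ 2.
  by under eq_bigr do rewrite sqrrN.
(* The upper half for [- W] bounds how far below zero the walk can be when a block starts. *)
have := lil_upper wt_ge0 wt_sum1 mX iidX sigma_gt0 W_mean' W_var' sigma2.
apply: filterS2 => w [N0 hN0] hw N.
(* [C] is such that the time [pos j.+1 + 2] is at most [exp (C j)], with iterated logarithm at most
   [ln j + ln C]. [J1] makes [ln C] at most [ln j / r ^ 2], and [J2] absorbs the extra 2 in the
   time. *)
pose C : R := 1 + t^-1 + ln M%:R.
have lnM0 : 0 <= ln M%:R :> R by rewrite ln_ge0// ler1n.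
have ti0 : 0 < t^-1 by rewrite invr_gt0.
have C1 : 1 <= C by rewrite /C; lra.
pose J1 := (Num.truncn (expR (r%:R ^+ 2 * ln C))).+1.
pose J2 := (4 * m)%N.
have [j] := hw (N + N0 + J1 + J2 + 2)%N.
rewrite -/(pos j) -/(pos j.+1) => hj hyj.
have jN : (N <= j)%N by apply: leq_trans hj; rewrite -!addnA leq_addr.
have jN0 : (N0 <= j)%N by apply: leq_trans hj; rewrite -!addnA addnCA leq_addr.
have jJ1 : (J1 <= j)%N by apply: leq_trans hj; rewrite addnAC addnAC -!addnA addnCA addnA addnCA leq_addr.
have jJ2 : (J2 <= j)%N by apply: leq_trans hj; rewrite -addnA addnCA leq_addr.
have j2 : (2 <= j)%N by apply: leq_trans hj; rewrite leq_addl.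
exists (pos j.+1); first by apply: (leq_trans jN); apply: (leq_trans (leqnSn j)); exact: pos_ge.
have hpos := hN0 _ (leq_trans jN0 (pos_ge j)).
have {}hpos : - Sw (word (pos j) w) <= 2 * sigma * lil_norm (pos j).
  by apply: le_trans hpos; rewrite -sumrN.
have j_gt0 : 0 < j%:R :> R by rewrite ltr0n (leq_trans _ j2).
have j_ge1 : 1 <= j%:R :> R by rewrite ler1n (leq_trans _ j2).
have j_pos : (pos j)%:R * (2 * r%:R ^+ 2) <= (len j)%:R :> R.
  by rewrite -mE -natrM ler_nat pos_le.
have j_len : 4 * (2 * r%:R ^+ 2) <= (len j)%:R :> R.
  by rewrite -mE -natrM ler_nat (leq_trans jJ2)// ltnW.
have lenE : (len j)%:R = (k j)%:R * (M ^ j)%:R :> R by rewrite -natrM.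
have posE : (pos j.+1).+2%:R = (pos j)%:R + (len j)%:R + 2 :> R.
  by rewrite /pos big_ord_recr/= -/(pos j) -addn2 !natrD.
have ell0 := lnj0 j; have hk := k_ge j; have kj0 : 0 < (k j)%:R :> R by rewrite ltr0n.
have hk2 := k_le j; have lnjj : ln j%:R <= j%:R :> R by rewrite ltW// ln_sublinear.
have lnC : r%:R ^+ 2 * ln C <= ln j%:R.
  rewrite -[leLHS]expRK ler_ln ?posrE ?expR_gt0//; apply/ltW.
  by apply: lt_le_trans (truncnS_gt _) _; rewrite ler_nat.
have lnC0 : 0 <= ln C by rewrite ln_ge0.
set n := (pos j.+1).+2 in posE *.
have r20 : 0 < r%:R ^+ 2 :> R by rewrite exprn_gt0.
have r21 : 1 <= r%:R ^+ 2 :> R by rewrite exprn_ege1.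
pose q : R := (r%:R ^+ 2)^-1.
have q0 : 0 < q by rewrite invr_gt0.
have q1 : q <= 1 by rewrite invf_le1.
have qr : r%:R ^+ 2 * q = 1 by rewrite divff// gt_eqF.
have q_le : q <= r%:R^-1.
  by rewrite lef_pV2 ?posrE// expr2 ler_pMr.
set l : R := (len j)%:R in j_pos j_len lenE posE *.
set ell : R := ln j%:R in ell0 hk hk2 lnjj lnC *.
have l0 : 0 <= l by rewrite ler0n.
have hn : n%:R <= l * (1 + q).
  rewrite posE; have : ((pos j)%:R + 2) * r%:R ^+ 2 <= l by nra.
  rewrite -ler_pdivlMr// -/q; lra.
have hp : (pos j)%:R <= l * q / 2.
  rewrite -(ler_pM2r r20); have -> : l * q / 2 * r%:R ^+ 2 = l * (r%:R ^+ 2 * q) / 2 by ring.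
  rewrite qr; lra.
have lv : ln (C * j%:R) <= ell * (1 + q).
  rewrite lnM ?posrE//; last by lra.
  have : ln C <= ell * q by rewrite /q ler_pdivlMr// mulrC.
  rewrite -/ell; lra.
have v1 : 1 <= C * j%:R by rewrite -[X in X <= _]mulr1 ler_pM.
have nv : n%:R <= expR (C * j%:R).
  apply: (@le_trans _ _ (2 * l)); first by nra.
  have -> : C * j%:R = j%:R + (j%:R / t + j%:R * ln M%:R) by rewrite /C; ring.
  rewrite expRD ler_pM//.
    by apply: le_trans (expR_ge1Dx _); rewrite -[2]/(1 + 1 : R) lerD2l.
  rewrite lenE expRD ler_pM//.
    apply: le_trans (expR_ge1Dx _).
    rewrite -(ler_pM2l t0) mulrDr mulr1 mulrCA divff ?gt_eqF// mulr1; lra.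
  by rewrite expRM_natl lnK ?posrE ?ltr0n// natrX.
have pv : (pos j)%:R <= expR (C * j%:R).
  by apply: le_trans nv; rewrite posE -addrA lerDl addr_ge0.
(* Common scale: the norm is at most [Q * (1 + q)] at the end of the block and [Q / r] at its start,
   while the block gains at least [a' * Q]. *)
pose Q := Num.sqrt (2 * l * ell).
have Q0 : 0 <= Q by exact: sqrtr_ge0.
have Q2 : Q ^+ 2 = 2 * l * ell by rewrite sqr_sqrtr// !mulr_ge0.
have g1 : lil_norm n <= Q * (1 + q).
  apply: (le_trans (lil_norm_le nv v1)).
  have -> : Q * (1 + q) = Num.sqrt ((Q * (1 + q)) ^+ 2).
    by rewrite sqrtr_sqr ger0_norm// mulr_ge0//; lra.
  apply: ler_wsqrtr; rewrite exprMn Q2.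
  have -> : 2 * l * ell * (1 + q) ^+ 2 = 2 * (l * (1 + q)) * (ell * (1 + q)) by ring.
  by rewrite ler_pM ?mulr_ge0 ?ln_ge0// ler_pM2l.
have g2 : lil_norm (pos j) <= Q / r%:R.
  apply: (le_trans (lil_norm_le pv v1)).
  have -> : Q / r%:R = Num.sqrt ((Q / r%:R) ^+ 2).
    by rewrite sqrtr_sqr ger0_norm// divr_ge0// ltW.
  apply: ler_wsqrtr; rewrite exprMn Q2 exprVn -/q.
  have -> : 2 * l * ell * q = 2 * (l * q / 2) * (ell * 2) by field.
  rewrite ler_pM ?mulr_ge0 ?ln_ge0// ?ler_pM2l//.
  by apply: (le_trans lv); rewrite ler_wpM2l//; lra.
have a'0 : 0 < a' by case/andP: a'b.
have gy : a' * Q <= y j.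
  have y0 : 0 <= y j.
    apply: mulr_ge0; first exact: ler0n.
    by rewrite mulr_ge0 ?sqrtr_ge0// mulr_ge0 ?sqrtr_ge0// ltW.
  have y2 : y j ^+ 2 = a' ^+ 2 * (2 * l * (t * (k j)%:R)).
    have e1 : Num.sqrt (2 * t) ^+ 2 = 2 * t by rewrite sqr_sqrtr// mulr_ge0// ltW.
    have e2 : Num.sqrt (M ^ j)%:R ^+ 2 = (M ^ j)%:R :> R by rewrite sqr_sqrtr.
    transitivity ((k j)%:R ^+ 2 * (a' ^+ 2 * Num.sqrt (2 * t) ^+ 2 * Num.sqrt (M ^ j)%:R ^+ 2)).
      by rewrite /y; ring.
    by rewrite e1 e2 lenE; ring.
  have aQ0 : 0 <= a' * Q by rewrite mulr_ge0// ltW.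
  rewrite -ler_sqr ?nnegrE// y2 exprMn Q2.
  apply: ler_wpM2l; first exact: sqr_ge0.
  by apply: ler_wpM2l => //; exact: mulr_ge0.
have S1 : y j - 2 * sigma * lil_norm (pos j) <= Sw (word (pos j.+1) w) by lra.
apply: le_trans S1.
have G1 : a * lil_norm n <= a * (Q * (1 + r%:R^-1)).
  rewrite ler_pM2l//; apply: (le_trans g1); rewrite ler_wpM2l//; lra.
have G2 : 2 * sigma * lil_norm (pos j) <= 2 * sigma * (Q / r%:R).
  by rewrite ler_pM2l// mulr_gt0.
have G3 : Q * ((a + 2 * sigma) / r%:R) <= Q * (a' - a).
  by rewrite ler_wpM2l// ler_pdivrMr// [leRHS]mulrC.
have E1 : a * (Q * (1 + r%:R^-1)) + 2 * sigma * (Q / r%:R) =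
  a * Q + Q * ((a + 2 * sigma) / r%:R) by field; rewrite gt_eqF.
lra.
Qed.

End lil_lower.

(** * Upper limits and the growth of the normalisation *)

Section limits.
Context {R : realType}.

Lemma limn_esup_eq (u : nat -> R) (l : R) :
  (forall e, 0 < e -> exists N, forall n, (N <= n)%N -> u n <= l + e) ->
  (forall e, 0 < e -> forall N, exists2 n, (N <= n)%N & l - e <= u n) ->
  limn_esup (fun n => (u n)%:E) = l%:E.
Proof.
move=> up lo; rewrite limn_esup_lim; apply/eqP; rewrite eq_le; apply/andP; split.
- apply/lee_addgt0Pr => e e0; have [N hN] := up e e0.
  apply: lime_le; first exact: is_cvg_esups.
  exists N => // n /= Nn; apply: ge_ereal_sup => _ [k /= nk <-].
  by rewrite -EFinD lee_fin hN// (leq_trans Nn).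
- apply: lime_ge; first exact: is_cvg_esups.
  apply: nearW => n; apply/lee_subgt0Pr => e e0.
  have [k nk hk] := lo e e0 n.
  apply: (@le_trans _ _ (u k)%:E); first by rewrite -EFinB lee_fin.
  by apply: ereal_sup_ubound; exists k.
Qed.

Lemma sqrtr_nat_unbounded (C : R) : exists N, forall n, (N <= n)%N -> C <= Num.sqrt n%:R.
Proof.
exists (Num.truncn (C ^+ 2)).+1 => n hn; apply: (le_trans (ler_norm C)).
rewrite -sqrtr_sqr ler_wsqrtr// ltW//.
by apply: lt_le_trans (truncnS_gt _) _; rewrite ler_nat.
Qed.

Lemma lil_norm_ge_sqrt : exists N, forall n, (N <= n)%N ->
  Num.sqrt n%:R <= lil_norm n :> R.
Proof.
exists (Num.truncn (expR (expR 1) : R)).+1 => n hn.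
have en : expR (expR 1) <= n%:R :> R.
  by rewrite ltW//; apply: lt_le_trans (truncnS_gt _) _; rewrite ler_nat.
have n0 : 0 < n%:R :> R by apply: lt_le_trans en; exact: expR_gt0.
have l1 : expR 1 <= ln n%:R :> R by rewrite -[leLHS]expRK ler_ln ?posrE ?expR_gt0.
have l2 : 1 <= ln (ln n%:R) :> R.
  rewrite -[leLHS]expRK ler_ln ?posrE ?expR_gt0//.
  by apply: lt_le_trans l1; exact: expR_gt0.
apply: ler_wsqrtr; nra.
Qed.

Lemma lil_norm_homo : exists N, forall k n, (N <= k)%N -> (k <= n)%N ->
  lil_norm k <= lil_norm n :> R.
Proof.
exists (Num.truncn (expR 1 : R)).+1 => k n hk kn.
have ek : expR 1 <= k%:R :> R.
  by rewrite ltW//; apply: lt_le_trans (truncnS_gt _) _; rewrite ler_nat.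
have k0 : 0 < k%:R :> R by apply: lt_le_trans ek; exact: expR_gt0.
have l1 : 1 <= ln k%:R :> R by rewrite -[leLHS]expRK ler_ln ?posrE ?expR_gt0.
have knR : k%:R <= n%:R :> R by rewrite ler_nat.
have n0 : 0 < n%:R :> R by exact: lt_le_trans knR.
have lkn : ln k%:R <= ln n%:R :> R by rewrite ler_ln ?posrE.
apply: ler_wsqrtr; apply: ler_pM.
- by rewrite mulr_ge0.
- by rewrite ln_ge0.
- by rewrite ler_pM2l.
- by rewrite ler_ln ?posrE//; lra.
Qed.

Lemma lil_norm_small (e : R) : 0 < e ->
  exists N, forall n, (N <= n)%N -> lil_norm n <= e * n%:R.
Proof.
(* The square of [lil_norm n] is at most [4 n sqrt n], hence at most [(e n) ^ 2] once
   [sqrt n >= 4 / e ^ 2]. *)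
move=> e0; have [N hN] := sqrtr_nat_unbounded (4 / e ^+ 2).
exists N.+1 => n hn; have n0 : 0 < n%:R :> R by rewrite ltr0n (leq_trans _ hn).
have := hN _ (ltnW hn); rewrite ler_pdivrMr ?exprn_gt0// => h4.
have s0 : 0 < Num.sqrt n%:R :> R by rewrite sqrtr_gt0.
have sE : n%:R = Num.sqrt n%:R ^+ 2 :> R by rewrite sqr_sqrtr// ltW.
set s := Num.sqrt n%:R in h4 s0 sE.
have en0 : 0 <= e * n%:R by rewrite mulr_ge0// ltW.
rewrite -[leRHS]ger0_norm// -sqrtr_sqr; apply: ler_wsqrtr.
have l1 : ln n%:R <= 2 * s.
  have -> : ln n%:R = 2 * ln s by rewrite sE lnXn// mulr_natl.
  rewrite ler_pM2l//; exact/ltW/ln_sublinear.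
have l2 : ln (ln n%:R) <= 2 * s.
  have [h|h] := leP (ln n%:R : R) 0; first by rewrite ln0// mulr_ge0// ltW.
  by apply: le_trans l1; exact/ltW/ln_sublinear.
apply: (@le_trans _ _ (2 * n%:R * (2 * s))).
  by apply: ler_wpM2l => //; rewrite mulr_ge0// ltW.
have -> : 2 * n%:R * (2 * s) = n%:R * (4 * s) by ring.
have -> : (e * n%:R) ^+ 2 = n%:R * (s * e ^+ 2 * s).
  transitivity (n%:R * (e ^+ 2 * n%:R)); first by ring.
  by congr (_ * _); rewrite sE; ring.
by rewrite ler_pM2l// ler_pM2r.
Qed.

(** The constant [c] is negligible against the norm. The index shift by 2 is absorbed in the upper
    bound by monotonicity of [lil_norm]; the lower bound is already stated at [k.+2]. *)
Lemma limn_esup_lil (S Z : nat -> R) (sigma c : R) : 0 < sigma ->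
  (forall n, Z n.+2 = c + S n) ->
  (forall m, exists N, forall k, (N <= k)%N ->
     S k <= (sigma + m.+1%:R^-1) * lil_norm k) ->
  (forall m N, exists2 k, (N <= k)%N &
     sigma * (1 - m.+2%:R^-1) * lil_norm k.+2 <= S k) ->
  limn_esup (fun n => (Z n / lil_norm n)%:E) = sigma%:E.
Proof.
move=> s0 ZE up lo.
have [N1 hN1] := lil_norm_ge_sqrt; have [N2 hN2] := lil_norm_homo.
have small e : 0 < e -> exists N, forall n, (N <= n)%N ->
    0 < lil_norm n :> R /\ `|c| <= e * lil_norm n.
  move=> e0; have [N3 hN3] := sqrtr_nat_unbounded (`|c| / e + 1).
  exists (N1 + N3)%N => n hn.
  have h1 := hN1 n (leq_trans (leq_addr _ _) hn).
  have h3 := hN3 n (leq_trans (leq_addl _ _) hn).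
  have c0 : 0 <= `|c| / e by rewrite divr_ge0// ltW.
  split; first by lra.
  by rewrite mulrC -ler_pdivrMr//; lra.
apply: limn_esup_eq => e e0.
- have e2 : 0 < e / 2 by lra.
  pose m := Num.truncn (e / 2)^-1.
  have hm : m.+1%:R^-1 <= e / 2.
    by rewrite -[leRHS]invrK lef_pV2 ?posrE ?invr_gt0// ltW// truncnS_gt.
  have [N3 hN3] := small _ e2; have [N4 hN4] := up m.
  exists (N2 + N3 + N4).+2 => -[//|[//|n]]; rewrite !ltnS => hn.
  have n2 : (N2 <= n)%N by apply: leq_trans hn; rewrite -addnA leq_addr.
  have n3 : (N3 <= n.+2)%N.
    by apply: (@leq_trans n); [apply: leq_trans hn; rewrite addnAC leq_addl|rewrite -addn2 leq_addr].
  have n4 : (N4 <= n)%N by apply: leq_trans hn; rewrite leq_addl.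
  have [g0 hc] := hN3 _ n3.
  rewrite ZE ler_pdivrMr//.
  have nn : (n <= n.+2)%N by rewrite -addn2 leq_addr.
  have gh := hN2 _ _ n2 nn.
  have h4 := hN4 _ n4.
  have hcc := ler_norm c.
  apply: (le_trans (lerD hcc h4)).
  have : (sigma + m.+1%:R^-1) * lil_norm n <= (sigma + e / 2) * lil_norm n.+2.
    have m0 : 0 <= m.+1%:R^-1 :> R by rewrite invr_ge0.
    by apply: ler_pM; [rewrite addr_ge0// ltW|exact: sqrtr_ge0|rewrite lerD2l|].
  move=> h; apply: (le_trans (lerD hc h)); rewrite -mulrDl ler_pM2r//; lra.
- move=> N; have e2 : 0 < e / 2 by lra.
  pose m := Num.truncn (sigma / (e / 2)).
  have hm : sigma * m.+2%:R^-1 <= e / 2.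
    rewrite ler_pdivrMr// mulrC -ler_pdivrMr//; apply/ltW.
    by apply: lt_trans (truncnS_gt _) _; rewrite ltr_nat.
  have [N3 hN3] := small _ e2.
  have [k hk hS] := lo m (N + N3)%N.
  exists k.+2; first by rewrite -addn2 (leq_trans (leq_addr N3 _))// (leq_trans hk)// leq_addr.
  have n3 : (N3 <= k.+2)%N.
    by rewrite -addn2 (leq_trans (leq_addl N _))// (leq_trans hk)// leq_addr.
  have [g0 hc] := hN3 _ n3.
  rewrite ZE ler_pdivlMr//.
  have hcc := ler_norm (- c); rewrite normrN in hcc.
  have : (sigma - e / 2) * lil_norm k.+2 <= sigma * (1 - m.+2%:R^-1) * lil_norm k.+2.
    by rewrite ler_pM2r// mulrBr mulr1 lerB.
  move=> h; have -> : (sigma - e) * lil_norm k.+2 = - (e / 2 * lil_norm k.+2)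
    + (sigma - e / 2) * lil_norm k.+2 by field.
  apply: lerD; last exact: le_trans h hS.
  by rewrite lerNl (le_trans hcc).
Qed.

Lemma cvg_div_nat_lil (S Z : nat -> R) (c C : R) : 0 < C ->
  (forall n, Z n.+2 = c + S n) ->
  (exists N, forall k, (N <= k)%N -> `|S k| <= C * lil_norm k) ->
  (fun n => Z n / n%:R) @ \oo --> (0 : R).
Proof.
move=> C0 ZE [N hN]; apply/cvgrPdist_le => e e0.
have eC : 0 < e / (2 * C) by rewrite divr_gt0// mulr_gt0.
have [N1 hN1] := lil_norm_small eC.
pose N2 := (Num.truncn (`|c| / (e / 2))).+1.
exists (N + N1 + N2).+2 => // -[//|[//|n]] /=; rewrite !ltnS => hn.
have n1 : (N <= n)%N by apply: leq_trans hn; rewrite -addnA leq_addr.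
have n2 : (N1 <= n)%N by apply: leq_trans hn; rewrite addnAC leq_addl.
have n3 : (N2 <= n)%N by apply: leq_trans hn; rewrite leq_addl.
have nn : n%:R <= n.+2%:R :> R by rewrite ler_nat -addn2 leq_addr.
have e2 : 0 < e / 2 by rewrite divr_gt0.
have hc : `|c| <= e / 2 * n.+2%:R.
  rewrite mulrC -ler_pdivrMr// ltW//; apply: lt_le_trans (truncnS_gt _) _.
  by apply: le_trans nn; rewrite ler_nat.
rewrite sub0r normrN ZE normrM normfV (ger0_norm (ler0n R n.+2)) ler_pdivrMr//.
apply: (le_trans (ler_normD _ _)).
have -> : e * n.+2%:R = e / 2 * n.+2%:R + e / 2 * n.+2%:R by field.
apply: lerD => //; apply: (le_trans (hN _ n1)).
apply: (@le_trans _ _ (C * (e / (2 * C) * n%:R))); first by rewrite ler_pM2l// hN1.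
have -> : C * (e / (2 * C) * n%:R) = e / 2 * n%:R by field; rewrite gt_eqF.
by rewrite ler_pM2l.
Qed.

End limits.

(** * Central limit theorem with a bounded perturbation *)

Section clt_shift.
Context {R : realType} {L : finType} (wt W : L -> R) (sigma : R).
Hypothesis wt_ge0 : forall l, 0 <= wt l.
Hypothesis wt_sum1 : \sum_l wt l = 1.
Hypothesis sigma_gt0 : 0 < sigma.
Hypothesis W_mean : \sum_l wt l * W l = 0.
Hypothesis W_var : \sum_l wt l * W l ^+ 2 = sigma ^+ 2.

(** Slutsky argument: [c] and [x * (sqrt (n + 2) - sqrt n)] are bounded, so together they are
    eventually below [eta * sqrt n], and [clt] at [x - eta] and [x + eta] squeezes the
    probability. *)
Lemma clt_shift (x c : R) :
  (fun n => Pw wt n (fun s => c + Sw W s <= x * Num.sqrt n.+2%:R)) @ \oo --> Phi (x / sigma).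
Proof.
apply/cvgrPdist_le => e e0.
have e2 : 0 < e / 2 by lra.
have /cvgrPdist_lt/(_ _ e2)[rho /= rho0 hrho] := @continuous_Phi R (x / sigma).
pose eta := rho * sigma / 2.
have eta0 : 0 < eta by rewrite divr_gt0// mulr_gt0.
have close y : `|x - y| = eta -> `|Phi (x / sigma) - Phi (y / sigma)| < e / 2.
  move=> xy; apply: hrho => /=.
  rewrite -mulrBl normrM normfV (gtr0_norm sigma_gt0) xy ltr_pdivrMr// /eta.
  by have := mulr_gt0 rho0 sigma_gt0; lra.
have c1 : `|Phi (x / sigma) - Phi ((x + eta) / sigma)| < e / 2.
  by apply: close; rewrite opprD addrA subrr add0r normrN gtr0_norm.
have c2 : `|Phi (x / sigma) - Phi ((x - eta) / sigma)| < e / 2.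
  by apply: close; rewrite opprB addrC subrK gtr0_norm.
have /cvgrPdist_le/(_ _ e2)[n1 _ h1] := clt wt_ge0 wt_sum1 W_mean sigma_gt0 W_var (y := x + eta).
have /cvgrPdist_le/(_ _ e2)[n2 _ h2] := clt wt_ge0 wt_sum1 W_mean sigma_gt0 W_var (y := x - eta).
have [n3 h3] := sqrtr_nat_unbounded ((2 * `|x| + `|c|) / eta).
exists (n1 + n2 + n3)%N => // n /= hn.
have {h1} := h1 n (leq_trans (leq_addr n2 _) (leq_trans (leq_addr n3 _) hn)).
have {h2} := h2 n (leq_trans (leq_addl n1 _) (leq_trans (leq_addr n3 _) hn)).
have {h3} := h3 n (leq_trans (leq_addl (n1 + n2) _) hn).
rewrite ler_pdivrMr// => h3 /= h2 h1.
have sn : `|Num.sqrt n.+2%:R - Num.sqrt n%:R| <= 2 :> R.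
  have le : Num.sqrt n%:R <= Num.sqrt n.+2%:R :> R.
    by rewrite ler_wsqrtr// ler_nat -addn2 leq_addr.
  rewrite ger0_norm ?subr_ge0// lerBlDl.
  have s0 : 0 <= Num.sqrt n%:R :> R by exact: sqrtr_ge0.
  have -> : Num.sqrt n%:R + 2 = Num.sqrt ((Num.sqrt n%:R + 2) ^+ 2) :> R.
    by rewrite sqrtr_sqr ger0_norm//; lra.
  apply: ler_wsqrtr; rewrite sqrrD sqr_sqrtr// -addn2 natrD.
  have := mulr_ge0 s0 (ler0n R 2); lra.
have hx : `|x * (Num.sqrt n.+2%:R - Num.sqrt n%:R)| <= 2 * `|x|.
  by rewrite normrM [leRHS]mulrC ler_wpM2l.
have l1 : Pw wt n (fun s => c + Sw W s <= x * Num.sqrt n.+2%:R) <=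
   Pw wt n (fun s => Sw W s <= (x + eta) * Num.sqrt n%:R).
  apply: Pw_le => // s _ hs.
  move: hx; rewrite ler_norml => /andP[_ hx].
  have := ler_norm (- c); rewrite normrN => hc; lra.
have l2 : Pw wt n (fun s => Sw W s <= (x - eta) * Num.sqrt n%:R) <=
   Pw wt n (fun s => c + Sw W s <= x * Num.sqrt n.+2%:R).
  apply: Pw_le => // s _ hs.
  move: hx; rewrite ler_norml => /andP[hx _].
  have := ler_norm c => hc; lra.
move: h1 h2 c1 c2 l1 l2; rewrite !ler_norml !ltr_norml; lra.
Qed.

End clt_shift.

(** * Encoding of the values 1, -1 and 0 *)

Section three_valued.
Context {R : realType}.

Definition trit_val (i : 'I_3) : R := nth 0 [:: 1; -1; 0] i.

(* The last class contains every [x] other than [1] and [-1], so that [trit] partitions the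
   whole sample space; it means [x = 0] only almost surely. *)
Definition trit (x : R) : 'I_3 :=
  if x == 1 then @Ordinal 3 0 isT else if x == -1 then @Ordinal 3 1 isT else @Ordinal 3 2 isT.

Definition trit_prob (p q r : R) (i : 'I_3) : R := nth 0 [:: p; q; r] i.

Lemma trit_valK (x : R) : x = 1 \/ x = -1 \/ x = 0 -> trit_val (trit x) = x.
Proof.
rewrite /trit => -[->|[->|->]]; rewrite ?eqxx//.
  by have /negbTE -> : (-1 : R) != 1 by apply/eqP; lra.
rewrite eq_sym oner_eq0.
by have /negbTE -> : (0 : R) != -1 by apply/eqP; lra.
Qed.

Lemma sum_trit (F : 'I_3 -> R) : \sum_i F i =
  F (@Ordinal 3 0 isT) + F (@Ordinal 3 1 isT) + F (@Ordinal 3 2 isT).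
Proof.
rewrite !big_ord_recl big_ord0 addr0 addrA.
by congr (F _ + F _ + F _); apply/val_inj.
Qed.

Lemma cvg_sum_trit (f : 'I_3 -> nat -> R) (l : 'I_3 -> R) :
  (forall i, f i n @[n --> \oo] --> l i) ->
  \sum_i f i n @[n --> \oo] --> \sum_i l i.
Proof.
move=> fl; rewrite sum_trit; under eq_fun do rewrite sum_trit.
by apply: cvgD; [apply: cvgD|].
Qed.

Lemma trit_preimageE (i : 'I_3) : trit @^-1` [set i] =
  if i == 0 :> nat then [set 1] else if i == 1%N :> nat then [set -1]
  else ~` ([set 1] `|` [set -1]).
Proof.
have n1 : (-1 : R) != 1 by apply/eqP; lra.
case: i => -[|[|[|//]]] i3; apply/seteqP; split => x /=; rewrite /trit.
- by case: eqP => // _; case: eqP.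
- by move=> ->; rewrite eqxx; apply/val_inj.
- by case: eqP => // _; case: eqP.
- by move=> ->; rewrite (negbTE n1) eqxx; apply/val_inj.
- by case: eqP => // ?; case: eqP => // ? _ [].
- move=> /not_orP[/eqP/negbTE -> /eqP/negbTE ->]; exact/val_inj.
Qed.

Lemma measurable_trit_preimage (i : 'I_3) : measurable (trit @^-1` [set i]).
Proof.
rewrite trit_preimageE; case: ifP => _; first exact: measurable_set1.
case: ifP => _; first exact: measurable_set1.
by apply: measurableC; apply: measurableU; exact: measurable_set1.
Qed.

End three_valued.

(** * Almost sure equality of events, and laws of three-valued variables *)

Section probability_facts.
Context {d : measure_display} {T : measurableType d} {R : realType} (P : probability T R).

Lemma probability_ae_eq (A B : set T) : measurable A -> measurable B ->
  {ae P, forall w, A w <-> B w} -> P A = P B.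
Proof.
move=> mA mB [N [mN PN hN]].
have le (C D : set T) : measurable C -> measurable D ->
    (forall w, ~ N w -> C w -> D w) -> (P C <= P D)%E.
  move=> mC mD CD; apply: (@le_trans _ _ (P (D `|` N))).
    apply: le_measure; rewrite ?inE//; first exact: measurableU.
    by move=> w Cw; have [Nw|Nw] := pselect (N w); [right|left; exact: CD].
  rewrite (le_trans (measureU2 _ _ _))//= PN adde0//.
have hAB w : ~ N w -> A w <-> B w.
  by move=> Nw; apply: contrapT => h; apply: Nw; exact: hN.
by apply/eqP; rewrite eq_le !le// => w /hAB[].
Qed.

Variables (f : T -> R) (p q r : R).
Hypothesis mf : measurable_fun setT f.
Hypothesis pqr : p + q + r = 1.
Hypothesis hf : P (f @^-1` [set 1]) = p%:E /\ P (f @^-1` [set -1]) = q%:E /\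
  P (f @^-1` [set 0]) = r%:E.

Let mpre B : measurable B -> measurable (f @^-1` B).
Proof. by move=> mB; rewrite -[X in measurable X]setTI; exact: mf. Qed.

Let one_neqN1 : 1 <> -1 :> R. Proof. lra. Qed.
Let one_neq0 : 1 <> 0 :> R. Proof. lra. Qed.
Let N1_neq0 : -1 <> 0 :> R. Proof. lra. Qed.

Let PU : P (f @^-1` [set 1] `|` f @^-1` [set -1]) = (p + q)%:E.
Proof.
have [h1 [h2 _]] := hf.
rewrite measureU.
- by rewrite [X in (X + _)%E]h1 [X in (_ + X)%E]h2.
- by apply: mpre; exact: measurable_set1.
- by apply: mpre; exact: measurable_set1.
- by apply/seteqP; split => // w /= [->].
Qed.

Lemma trit_law i : P (f @^-1` (trit @^-1` [set i])) = (trit_prob p q r i)%:E.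
Proof.
have [h1 [h2 h3]] := hf.
rewrite trit_preimageE; case: i => -[|[|[|//]]] i3 //=.
have -> : f @^-1` (~` ([set 1] `|` [set -1])) = ~` (f @^-1` [set 1] `|` f @^-1` [set -1]).
  by apply/seteqP; split => w.
rewrite probability_setC; last first.
  by apply: measurableU; apply: mpre; exact: measurable_set1.
by rewrite PU -EFinB; congr (_%:E); rewrite /trit_prob/= -pqr addrC addKr.
Qed.

Lemma ae_three_valued : {ae P, forall w, f w = 1 \/ f w = -1 \/ f w = 0}.
Proof.
have [_ [_ h3]] := hf.
have m1 : measurable (f @^-1` [set 1] `|` f @^-1` [set -1]).
  by apply: measurableU; apply: mpre; exact: measurable_set1.
have m0 : measurable (f @^-1` [set 0]) by apply: mpre; exact: measurable_set1.
exists (~` (f @^-1` [set 1] `|` f @^-1` [set -1] `|` f @^-1` [set 0])); split.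
- by apply: measurableC; exact: measurableU.
- rewrite probability_setC; last exact: measurableU.
  suff -> : P (f @^-1` [set 1] `|` f @^-1` [set -1] `|` f @^-1` [set 0]) = 1%E.
    by rewrite subee.
  rewrite measureU//; last by apply/seteqP; split => // w /= [[|] ->].
  transitivity ((p + q)%:E + r%:E)%E; last by rewrite -EFinD pqr.
  by congr (_ + _)%E; [exact: PU|exact: h3].
- by move=> w /= h [[|]|] h'; apply: h; [left|right; left|right; right].
Qed.

End probability_facts.

(** * The elephant random walk driven by independent letters *)

Section erw_letters.
Context {R : realType} {d : measure_display} {T : measurableType d} (P : probability T R).
Variables (p q r : R) (X1 : T -> R) (eta K : nat -> T -> R).
Hypotheses (hp : 0 < p < 1) (hq : 0 < q < 1) (hr : 0 < r < 1) (hpqr : p + q + r = 1).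
Hypothesis hX1 : P (X1 @^-1` [set 1]) = p%:E /\ P (X1 @^-1` [set -1]) = q%:E /\
  P (X1 @^-1` [set 0]) = r%:E.
Hypothesis heta : forall n, (2 <= n)%N ->
  P (eta n @^-1` [set 1]) = p%:E /\ P (eta n @^-1` [set -1]) = q%:E /\
  P (eta n @^-1` [set 0]) = r%:E.
Hypothesis hK : forall n, (3 <= n)%N ->
  P (K n @^-1` [set 1]) = (2^-1)%:E /\ P (K n @^-1` [set 2]) = (2^-1)%:E.

Let fam := fun i : nat + nat =>
  match i with
  | inl 0 => X1
  | inl n.+1 => eta n.+2
  | inr n => K n.+3
  end.
Hypothesis hind : mutual_indep P fam.

Local Notation L := ('I_3 * bool)%type.

Definition erw_wt (l : L) : R := trit_prob p q r l.1 / 2.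

(* Letter [n] drives step [n + 3] of the walk. *)
Definition erw_letter (n : nat) (w : T) : L := (trit (eta n.+3 w), K n.+3 w == 1).

(** The centred step of the walk, conditionally on its first two steps being [x1] and [x2]. *)
Definition erw_W (x1 x2 : R) (l : L) : R :=
  trit_val l.1 * (if l.2 then x1 else x2) - erw_mu p q x1 x2.

Let sumL (F : L -> R) : \sum_l F l = \sum_i (F (i, true) + F (i, false)).
Proof.
rewrite (eq_bigr (fun l => F (l.1, l.2))); last by case.
rewrite -(pair_bigA _ (fun i b => F (i, b)))/=.
by apply: eq_bigr => i _; rewrite big_bool.
Qed.

Lemma erw_wt_ge0 l : 0 <= erw_wt l.
Proof.
case/andP: hp => p0 _; case/andP: hq => q0 _; case/andP: hr => r0 _.
rewrite /erw_wt divr_ge0//; case: l => -[[|[|[|//]]] i3] b; rewrite /trit_prob/=; exact: ltW.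
Qed.

Lemma erw_wt_sum1 : \sum_l erw_wt l = 1.
Proof. by rewrite sumL sum_trit /erw_wt /trit_prob/= -[RHS]hpqr; field. Qed.

Lemma erw_W_mean x1 x2 : \sum_l erw_wt l * erw_W x1 x2 l = 0.
Proof.
rewrite sumL sum_trit /erw_wt /erw_W /trit_prob /trit_val /erw_mu/=.
have -> : r = 1 - p - q by rewrite -hpqr; ring.
by field.
Qed.

Lemma erw_W_var x1 x2 : \sum_l erw_wt l * erw_W x1 x2 l ^+ 2 =
  (p + q) * (x1 ^+ 2 + x2 ^+ 2) / 2 - erw_mu p q x1 x2 ^+ 2.
Proof.
rewrite sumL sum_trit /erw_wt /erw_W /trit_prob /trit_val /erw_mu/=.
have -> : r = 1 - p - q by rewrite -hpqr; ring.
by field.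
Qed.

(** The variance is [(p + q - (p - q)^2) (x1^2 + x2^2) / 2] plus a square, and [p + q - (p - q)^2 =
    (p + q) r + 4 p q > 0]. *)
Lemma erw_var_gt0 x1 x2 : x1 ^+ 2 + x2 ^+ 2 != 0 ->
  0 < (p + q) * (x1 ^+ 2 + x2 ^+ 2) / 2 - erw_mu p q x1 x2 ^+ 2.
Proof.
move=> xx; have xx0 : 0 < x1 ^+ 2 + x2 ^+ 2.
  by rewrite lt_neqAle eq_sym xx addr_ge0// sqr_ge0.
case/andP: hp => p0 _; case/andP: hq => q0 _; case/andP: hr => r0 _.
have -> : (p + q) * (x1 ^+ 2 + x2 ^+ 2) / 2 - erw_mu p q x1 x2 ^+ 2 =
  ((p + q) - (p - q) ^+ 2) * (x1 ^+ 2 + x2 ^+ 2) / 2 + ((p - q) * (x1 - x2) / 2) ^+ 2.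
  by rewrite /erw_mu; field.
have h : 0 < (p + q) - (p - q) ^+ 2.
  have -> : (p + q) - (p - q) ^+ 2 = (p + q) * (1 - (p + q)) + 4 * p * q by ring.
  have -> : 1 - (p + q) = r by rewrite -hpqr; ring.
  by rewrite addr_gt0// !mulr_gt0// addr_gt0.
by rewrite ltr_wpDr ?sqr_ge0// divr_gt0// mulr_gt0.
Qed.

Lemma measurable_eta n : (2 <= n)%N -> measurable_fun setT (eta n).
Proof. by case: n => [|[|n]] // _; exact: (hind.1 (inl n.+1)). Qed.

Lemma measurable_K n : (3 <= n)%N -> measurable_fun setT (K n).
Proof. by case: n => [|[|[|n]]] // _; exact: (hind.1 (inr n)). Qed.

Lemma measurable_X1 : measurable_fun setT X1.
Proof. exact: (hind.1 (inl 0%N)). Qed.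

(** Matches the test in [erw_X]: the second class is the complement of [K = 1], which differs from
    [K = 2] by a null set only. *)
Let BK (b : bool) : set R := [set x | (x == 1) = b].

Let BKE b : BK b = if b then [set 1] else ~` [set 1].
Proof.
apply/seteqP; split => x; rewrite /BK /=; case: b => /=.
- by move/eqP.
- by move=> /negbT/eqP.
- by move=> ->; rewrite eqxx.
- by move=> /eqP/negbTE.
Qed.

Let mBK b : measurable (BK b).
Proof.
rewrite BKE; case: b; first exact: measurable_set1.
by apply: measurableC; exact: measurable_set1.
Qed.

Let PBK n b : P (K n.+3 @^-1` BK b) = (2^-1)%:E.
Proof.
rewrite BKE; have [h _] := @hK n.+3 isT; case: b => //.
rewrite -preimage_setC probability_setC; last first.
  by rewrite -[X in measurable X]setTI; apply: measurable_K => //; exact: measurable_set1.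
have -> : P (K n.+3 @^-1` [set 1]) = (2^-1)%:E by exact: h.
by rewrite -EFinB; congr (_%:E); field.
Qed.

Lemma measurable_letter n l : measurable [set w | erw_letter n w = l].
Proof.
have -> : [set w | erw_letter n w = l] =
    eta n.+3 @^-1` (trit @^-1` [set l.1]) `&` K n.+3 @^-1` (BK l.2).
  apply/seteqP; split => w /=; rewrite /erw_letter; first by move=> <-.
  by case: l => l1 l2 /= [-> ->].
apply: measurableI; rewrite -[X in measurable X]setTI.
  by apply: measurable_eta => //; exact: measurable_trit_preimage.
by apply: measurable_K => //; exact: mBK.
Qed.

(** In the independent family [inl 0] and [inl 1] are [X1] and [eta 2], while [inl n.+2] and [inr n]
    are the two components of letter [n]. Hence the letters are independent with law [erw_wt], and
    independent of the first two steps. *)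
Lemma erw_indep (B0 B1 : set R) (s : seq L) : measurable B0 -> measurable B1 ->
  P ((X1 @^-1` B0 `&` eta 2 @^-1` B1) `&` [set w | word erw_letter (size s) w = s]) =
  (P (X1 @^-1` B0) * P (eta 2 @^-1` B1) * (\prod_(l <- s) erw_wt l)%:E)%E.
Proof.
move=> mB0 mB1.
pose l0 : L := (@Ordinal 3 0 isT, true).
pose B (i : nat + nat) : set R := match i with
  | inl 0 => B0 | inl 1 => B1
  | inl n.+2 => trit @^-1` [set (nth l0 s n).1]
  | inr n => BK (nth l0 s n).2 end.
pose I := iota 0 (size s).
pose J : seq (nat + nat) := inl 0%N :: inl 1%N ::
  ([seq inl n.+2 | n <- I] ++ [seq inr n | n <- I]).
have uJ : uniq J.
  have injl : injective (fun n => inl n.+2 : nat + nat) by move=> ? ? [].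
  have injr : injective (fun n => inr n : nat + nat) by move=> ? ? [].
  rewrite /J /= cat_uniq !map_inj_uniq ?iota_uniq//= andbT.
  rewrite !in_cons !mem_cat/=.
  apply/and3P; split.
  - by rewrite negb_or; apply/andP; split; apply/mapP => -[].
  - by rewrite negb_or; apply/andP; split; apply/mapP => -[].
  - by apply/hasPn => _ /mapP[n _ ->]; apply/mapP => -[].
have mB i : measurable (B i).
  by case: i => [[|[|n]]|n] //=; exact: measurable_trit_preimage.
have := hind.2 J B uJ mB.
rewrite /J !big_cons big_cat !big_map/= -/I.
have -> : (\prod_(n <- I) P (eta n.+3 @^-1` (trit @^-1` [set (nth l0 s n).1])) =
   (\prod_(n <- I) trit_prob p q r (nth l0 s n).1)%:E)%E.
  rewrite -prodEFin; apply: eq_bigr => n _.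
  by apply: trit_law => //; [exact: measurable_eta|exact: heta].
have -> : (\prod_(n <- I) P (K n.+3 @^-1` BK (nth l0 s n).2) =
   (\prod_(n <- I) 2^-1)%:E)%E.
  by rewrite -prodEFin; apply: eq_bigr => n _; exact: PBK.
have -> : \prod_(l <- s) erw_wt l = \prod_(n <- I) (trit_prob p q r (nth l0 s n).1 / 2).
  by rewrite (big_nth l0) /index_iota subn0.
rewrite -EFinM -big_split/= muleA => <-.
congr (P _); apply/seteqP; split => w /=.
- move=> [[h0 h1] hw] i /=; rewrite !in_cons => /orP[/eqP ->//|/orP[/eqP -> //|]].
  have hn n : n \in I -> erw_letter n w = nth l0 s n.
    by rewrite mem_iota/= add0n => ns; rewrite -hw nth_mkseq.
  by rewrite mem_cat => /orP[] /mapP[n /hn nI ->] /=; rewrite -nI.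
- move=> h; split.
    by split; [exact: (h (inl 0%N))|exact: (h (inl 1%N))].
  apply: (@eq_from_nth _ l0); first by rewrite size_word.
  move=> n; rewrite size_word => ns; rewrite nth_mkseq//.
  have nI : n \in I by rewrite mem_iota/= add0n.
  have h1 : trit (eta n.+3 w) = (nth l0 s n).1.
    apply: (h (inl n.+2)) => /=; rewrite !in_cons/= mem_cat; apply/orP; left.
    by apply/mapP; exists n.
  have h2 : (K n.+3 w == 1) = (nth l0 s n).2.
    apply: (h (inr n)) => /=; rewrite !in_cons/= mem_cat; apply/orP; right.
    by apply/mapP; exists n.
  by rewrite /erw_letter h1 h2; case: (nth l0 s n).
Qed.

(** The prescribed values are taken only almost surely; at these sample points [trit_val] inverts
    [trit], and the letters together with the first two steps determine the walk. *)
Let good (w : T) := (X1 w = 1 \/ X1 w = -1 \/ X1 w = 0) /\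
  forall n, eta n.+2 w = 1 \/ eta n.+2 w = -1 \/ eta n.+2 w = 0.

Let ae_good : {ae P, forall w, good w}.
Proof.
have h1 : {ae P, forall w, forall n, eta n.+2 w = 1 \/ eta n.+2 w = -1 \/ eta n.+2 w = 0}.
  apply: ae_foralln => n.
  by apply: ae_three_valued hpqr _; [exact: measurable_eta|exact: heta].
have h2 := ae_three_valued measurable_X1 hpqr hX1.
by apply: filterS2 h2 h1 => w ? ?; split.
Qed.

(** Contribution of the first two steps: [erw_Z] subtracts [n + 2] means at time [n + 2], of which
    only [n] are absorbed by [erw_W]. *)
Let shift x1 x2 : R := x1 + x2 - 2 * erw_mu p q x1 x2.

Let erw_ZE w n x1 x2 : good w -> X1 w = x1 -> eta 2 w * X1 w = x2 ->
  erw_Z X1 eta K p q n.+2 w = shift x1 x2 + Sw (erw_W x1 x2) (word erw_letter n w).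
Proof.
move=> [_ gw] hx1 hx2.
suff H : erw_S X1 eta K n.+2 w =
    x1 + x2 + Sw (erw_W x1 x2) (word erw_letter n w) + n%:R * erw_mu p q x1 x2.
  have nE : n.+2%:R = n%:R + 2 :> R by rewrite -[n.+2]addn2 natrD.
  by rewrite /erw_Z H /= hx2 hx1 /shift nE /erw_mu; field.
elim: n => [|n IH].
  rewrite /erw_S /index_iota/= !big_cons big_nil /Sw big_nil/= hx2 hx1; ring.
have -> : erw_S X1 eta K n.+3 w = erw_S X1 eta K n.+2 w + erw_X X1 eta K n.+3 w.
  by rewrite /erw_S big_nat_recr.
rewrite IH wordS -cats1 Sw_cat -natr1.
have -> : Sw (erw_W x1 x2) [:: erw_letter n w] = erw_X X1 eta K n.+3 w - erw_mu p q x1 x2.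
  by rewrite /Sw big_seq1 /erw_W /= (trit_valK (gw n.+1)) hx2 hx1.
by ring.
Qed.

Let erw_iid (s : seq L) :
  P [set w | word erw_letter (size s) w = s] = (\prod_(l <- s) erw_wt l)%:E.
Proof.
have := @erw_indep setT setT s measurableT measurableT.
by rewrite !preimage_setT !setTI !probability_setT !mul1e.
Qed.

Let E0 i j := X1 @^-1` (trit @^-1` [set i]) `&` eta 2 @^-1` (trit @^-1` [set j]).

Let mE0 i j : measurable (E0 i j).
Proof.
apply: measurableI; rewrite -[X in measurable X]setTI.
  by apply: measurable_X1 => //; exact: measurable_trit_preimage.
by apply: measurable_eta => //; exact: measurable_trit_preimage.
Qed.

Let pr := trit_prob p q r.

Let PE0 i j : P (E0 i j) = (pr i * pr j)%:E.
Proof.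
have := @erw_indep (trit @^-1` [set i]) (trit @^-1` [set j]) [::]
  (measurable_trit_preimage i) (measurable_trit_preimage j).
rewrite big_nil mule1 (_ : [set w | _] = setT); last by apply/seteqP.
rewrite setIT => ->; rewrite EFinM; congr (_ * _)%E.
  by apply: trit_law => //; exact: measurable_X1.
by apply: trit_law => //; [exact: measurable_eta|exact: heta].
Qed.

Let erw_word_law i j n (A : pred (seq L)) :
  P (E0 i j `&` [set w | A (word erw_letter n w)]) = (pr i * pr j * Pw erw_wt n A)%:E.
Proof.
rewrite (word_law (wt := erw_wt) measurable_letter (mE0 i j)).
  by rewrite PE0.
move=> s; have := @erw_indep (trit @^-1` [set i]) (trit @^-1` [set j]) s
  (measurable_trit_preimage i) (measurable_trit_preimage j).
rewrite /E0 => ->; congr (_ * _)%E.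
have := @erw_indep (trit @^-1` [set i]) (trit @^-1` [set j]) [::]
  (measurable_trit_preimage i) (measurable_trit_preimage j).
rewrite big_nil mule1 (_ : [set w | _] = setT); last by apply/seteqP.
by rewrite setIT.
Qed.

Let measurable_erw_X n : measurable_fun setT (erw_X X1 eta K n).
Proof.
have m2 : measurable_fun setT (fun w => eta 2 w * X1 w).
  by apply: measurable_funM; [exact: measurable_eta|exact: measurable_X1].
case: n => [|[|[|n]]].
- exact: measurable_cst.
- exact: measurable_X1.
- exact: m2.
- apply: measurable_funM; first exact: measurable_eta.
  apply: measurable_fun_ifT => //; last exact: measurable_X1.
  apply: (@measurable_fun_eqr _ _ _ _ (K n.+3) (cst 1)); first exact: measurable_K.
  exact: measurable_cst.
Qed.

Let measurable_erw_Z n : measurable_fun setT (erw_Z X1 eta K p q n).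
Proof.
apply: measurable_funB.
  exact: measurable_sum.
apply: measurable_funM; last exact: measurable_cst.
apply: measurable_funM; first exact: measurable_cst.
by apply: measurable_funD; [exact: measurable_X1|exact: (measurable_erw_X 2)].
Qed.

(** Total probability over the values of [X1] and [eta 2]; the second step is their product. The
    events on both sides agree at [good] points, hence almost surely. *)
Lemma erw_cdf n x : P [set w | erw_Z X1 eta K p q n.+2 w / Num.sqrt n.+2%:R <= x] =
  (\sum_i \sum_j pr i * pr j * Pw erw_wt n (fun s =>
     shift (trit_val i) (trit_val j * trit_val i) +
       Sw (erw_W (trit_val i) (trit_val j * trit_val i)) s <= x * Num.sqrt n.+2%:R))%:E.
Proof.
set A := [set w | _].
have mA : measurable A.
  have mZ : measurable_fun setT (fun w => erw_Z X1 eta K p q n.+2 w / Num.sqrt n.+2%:R).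
    by apply: measurable_funM; [exact: measurable_erw_Z|exact: measurable_cst].
  have -> : A = (fun w => erw_Z X1 eta K p q n.+2 w / Num.sqrt n.+2%:R) @^-1` [set` `]-oo, x]].
    by apply/seteqP; split => w /=; rewrite in_itv.
  by rewrite -[X in measurable X]setTI; apply: mZ => //; exact: measurable_itv.
have mt (f : T -> R) i : measurable_fun setT f -> measurable [set w | trit (f w) = i].
  move=> mf; rewrite -[X in measurable X]setTI.
  exact: (mf measurableT _ (measurable_trit_preimage i)).
have m1 i := mt _ i measurable_X1; have m2 i := mt _ i (measurable_eta (isT : 2 <= 2)%N).
rewrite (measure_fin_partition P m1 mA) -sumEFin; apply: eq_bigr => i _.
rewrite (measure_fin_partition P m2); last exact: measurableI.
rewrite -sumEFin; apply: eq_bigr => j _.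
set B := (X in Pw _ _ X).
rewrite -erw_word_law; apply: probability_ae_eq.
- by apply: measurableI => //; exact: measurableI.
- by apply: measurableI => //; exact: (measurable_word measurable_letter n B).
- apply: filterS ae_good => w gw.
  have s0 : 0 < Num.sqrt n.+2%:R :> R by rewrite sqrtr_gt0.
  have e1 : trit (X1 w) = i -> X1 w = trit_val i by move=> <-; rewrite trit_valK//; case: gw.
  have e2 : trit (eta 2 w) = j -> eta 2 w = trit_val j.
    by move=> <-; rewrite trit_valK//; case: gw => _ /(_ 0%N).
  have ZE : trit (X1 w) = i -> trit (eta 2 w) = j ->
      (erw_Z X1 eta K p q n.+2 w / Num.sqrt n.+2%:R <= x) = B (word erw_letter n w).
    move=> /e1 h1 /e2 h2; rewrite ler_pdivrMr//.
    by rewrite (erw_ZE n gw h1 (x2 := trit_val j * trit_val i))// h1 h2.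
  rewrite /A /E0 /=; split.
    by move=> [[h h1] h2]; rewrite -ZE.
  by move=> [[h1 h2] h]; rewrite ZE.
Qed.

Let sigma_ x1 x2 := erw_sigma p q x1 x2.

Let sigma_gt0 x1 x2 : x1 ^+ 2 + x2 ^+ 2 != 0 -> 0 < sigma_ x1 x2.
Proof. by move=> h; rewrite sqrtr_gt0 erw_var_gt0. Qed.

Let sigma_sqr x1 x2 : x1 ^+ 2 + x2 ^+ 2 != 0 ->
  \sum_l erw_wt l * erw_W x1 x2 l ^+ 2 = sigma_ x1 x2 ^+ 2.
Proof. by move=> h; rewrite erw_W_var sqr_sqrtr// ltW// erw_var_gt0. Qed.

Let trit_val_neq0 (i : 'I_3) y : i != @Ordinal 3 2 isT -> (trit_val i : R) ^+ 2 + y ^+ 2 != 0.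
Proof.
move=> i2; rewrite gt_eqF// ltr_wpDr ?sqr_ge0//.
by case: i i2 => -[|[|[|//]]] i3 //= _; rewrite /trit_val/= ?sqrrN expr1n.
Qed.

Lemma erw_cvg_in_distribution x :
  (fun n => fine (P [set w | erw_Z X1 eta K p q n w / Num.sqrt n%:R <= x])) @ \oo -->
  p * (p + q) * Phi (x / Num.sqrt (p + q - (p - q) ^+ 2))
  + r * (p + q) * Phi (x / Num.sqrt ((p + q) / 2 - ((p - q) / 2) ^+ 2))
  + q * (p + q) * Phi (x / Num.sqrt (p + q)) + r * (if 0 <= x then 1 else 0).
Proof.
rewrite -(cvg_shiftn 2)/=.
pose lim (i j : 'I_3) : R := if i == @Ordinal 3 2 isT then (if 0 <= x then 1 else 0)
  else Phi (x / sigma_ (trit_val i) (trit_val j * trit_val i)).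
have cv i j : pr i * pr j * Pw erw_wt n (fun s =>
     shift (trit_val i) (trit_val j * trit_val i) +
       Sw (erw_W (trit_val i) (trit_val j * trit_val i)) s <= x * Num.sqrt n.+2%:R)
     @[n --> \oo] --> pr i * pr j * lim i j.
  apply: cvgMr; rewrite /lim; case: eqP => [->|/eqP i2].
    (* With a zero first step everything vanishes, and the probability equals the indicator of
       [0 <= x] for every [n]. *)
    rewrite {1}/trit_val/= mulr0 /shift /erw_mu !(addr0, mulr0, mul0r, subr0, oppr0).
    have W0 l : erw_W 0 0 l = 0 by rewrite /erw_W /erw_mu; case: ifP => _; ring.
    have S0 s : Sw (erw_W 0 0) s = 0 by rewrite /Sw big1// => l _; exact: W0.
    have cst0 n : Pw erw_wt n (fun s => 0 + Sw (erw_W 0 0) s <= x * Num.sqrt n.+2%:R) =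
        (if 0 <= x then 1 else 0).
      rewrite /Pw -[RHS](Ew_cst erw_wt_sum1 n); apply: Ew_eq => s _.
      by rewrite S0 addr0 pmulr_lge0 ?sqrtr_gt0//; case: ifP.
    under eq_fun do rewrite cst0.
    exact: cvg_cst.
  apply: clt_shift => //.
  - exact: erw_wt_ge0.
  - exact: erw_wt_sum1.
  - exact/sigma_gt0/trit_val_neq0.
  - exact: erw_W_mean.
  - exact/sigma_sqr/trit_val_neq0.
have -> : p * (p + q) * Phi (x / Num.sqrt (p + q - (p - q) ^+ 2))
  + r * (p + q) * Phi (x / Num.sqrt ((p + q) / 2 - ((p - q) / 2) ^+ 2))
  + q * (p + q) * Phi (x / Num.sqrt (p + q)) + r * (if 0 <= x then 1 else 0) =
  \sum_i \sum_j pr i * pr j * lim i j.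
  (* First two steps of equal sign give the variance [p + q - (p - q)^2], with total weight
     [p (p + q)]; opposite signs give [p + q], with weight [q (p + q)]; a zero second step after a
     nonzero one has weight [r (p + q)]. *)
  have sE x1 x2 v : (p + q) * (x1 ^+ 2 + x2 ^+ 2) / 2 - ((p - q) * (x1 + x2) / 2) ^+ 2 = v ->
    sigma_ x1 x2 = Num.sqrt v by move=> <-.
  rewrite !sum_trit /lim /trit_val /pr /trit_prob/=.
  rewrite !(mul1r, mulr1, mulrNN, mulN1r, mulrN1, opprK, mul0r, oppr0).
  rewrite (sE 1 1 (p + q - (p - q) ^+ 2)); last by field.
  rewrite (sE 1 (-1) (p + q)); last by field.
  rewrite (sE 1 0 ((p + q) / 2 - ((p - q) / 2) ^+ 2)); last by field.
  rewrite (sE (-1) (-1) (p + q - (p - q) ^+ 2)); last by field.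
  rewrite (sE (-1) 1 (p + q)); last by field.
  rewrite (sE (-1) 0 ((p + q) / 2 - ((p - q) / 2) ^+ 2)); last by field.
  set c := (if _ then _ else _).
  have -> : r * c = r * (p + q + r) * c by rewrite hpqr mulr1.
  by ring.
under eq_fun do rewrite addn2 erw_cdf/=.
by apply: cvg_sum_trit => i; apply: cvg_sum_trit => j; exact: cv.
Qed.

(** Margins are indexed by naturals [m] so that only countably many null sets occur. Both signs are
    recorded, the lower limit being treated through [- W]. *)
Let lil_facts x1 x2 w := forall m,
  [/\ exists N, forall k, (N <= k)%N ->
        Sw (erw_W x1 x2) (word erw_letter k w) <= (sigma_ x1 x2 + m.+1%:R^-1) * lil_norm k,
      exists N, forall k, (N <= k)%N ->
        - Sw (erw_W x1 x2) (word erw_letter k w) <= (sigma_ x1 x2 + m.+1%:R^-1) * lil_norm k,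
      forall N, exists2 k, (N <= k)%N &
        sigma_ x1 x2 * (1 - m.+2%:R^-1) * lil_norm k.+2
          <= Sw (erw_W x1 x2) (word erw_letter k w)
    & forall N, exists2 k, (N <= k)%N &
        sigma_ x1 x2 * (1 - m.+2%:R^-1) * lil_norm k.+2
          <= - Sw (erw_W x1 x2) (word erw_letter k w)].

Let ae_lil_facts x1 x2 : x1 ^+ 2 + x2 ^+ 2 != 0 -> {ae P, forall w, lil_facts x1 x2 w}.
Proof.
move=> xx; apply: ae_foralln => m.
have s0 := sigma_gt0 xx.
have WN_mean : \sum_l erw_wt l * - erw_W x1 x2 l = 0.
  by under eq_bigr do rewrite mulrN; rewrite sumrN erw_W_mean oppr0.
have WN_var : \sum_l erw_wt l * (- erw_W x1 x2 l) ^+ 2 = sigma_ x1 x2 ^+ 2.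
  by under eq_bigr do rewrite sqrrN; exact: sigma_sqr.
have SwN s : Sw (fun l => - erw_W x1 x2 l) s = - Sw (erw_W x1 x2) s by rewrite /Sw sumrN.
have up : sigma_ x1 x2 < sigma_ x1 x2 + m.+1%:R^-1 by rewrite ltrDl invr_gt0.
have lo : 0 < sigma_ x1 x2 * (1 - m.+2%:R^-1) < sigma_ x1 x2.
  have h1 : 0 < m.+2%:R^-1 :> R by rewrite invr_gt0 ltr0n.
  have h2 : m.+2%:R^-1 < 1 :> R by rewrite invf_lt1// ltr1n.
  apply/andP; split; first by rewrite mulr_gt0// subr_gt0.
  by rewrite gtr_pMr// ltrBlDr ltrDl.
have u1 := lil_upper erw_wt_ge0 erw_wt_sum1 measurable_letter erw_iid s0
  (erw_W_mean x1 x2) (sigma_sqr xx) up.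
have u2 := lil_upper erw_wt_ge0 erw_wt_sum1 measurable_letter erw_iid s0 WN_mean WN_var up.
have l1 := lil_lower erw_wt_ge0 erw_wt_sum1 measurable_letter erw_iid s0
  (erw_W_mean x1 x2) (sigma_sqr xx) lo.
have l2 := lil_lower erw_wt_ge0 erw_wt_sum1 measurable_letter erw_iid s0 WN_mean WN_var lo.
apply: filterS2 (filterI u1 u2) (filterI l1 l2) => w [h1 h2] [h3 h4].
split => //.
- by case: h2 => N hN; exists N => k /hN; rewrite SwN.
- by move=> N; case: (h4 N) => k Nk hk; exists k => //; rewrite -SwN.
Qed.

(** The first two steps take finitely many values, so almost surely the facts hold for all fixed
    pairs at once, in particular for the pair realised at [w]. *)
Lemma ae_erw_path : {ae P, forall w, good w /\
  (X1 w ^+ 2 + (eta 2 w * X1 w) ^+ 2 != 0 -> lil_facts (X1 w) (eta 2 w * X1 w) w)}.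
Proof.
(* [ae_foralln] ranges over naturals; [inord] maps them onto ['I_3]. *)
have h : {ae P, forall w, forall n m : nat,
    let x1 := trit_val (inord n) in let x2 := trit_val (inord m) * x1 in
    x1 ^+ 2 + x2 ^+ 2 != 0 -> lil_facts x1 x2 w}.
  apply: ae_foralln => n; apply: ae_foralln => m.
  pose x1 : R := trit_val (inord n); pose x2 : R := trit_val (inord m) * x1.
  have [e|e] := eqVneq (x1 ^+ 2 + x2 ^+ 2) 0.
    by apply: aeW => w /=; rewrite -/x1 -/x2 e eqxx.
  by apply: filterS (ae_lil_facts e) => w.
apply: filterS2 ae_good h => w gw hw; split => //.
have := hw (trit (X1 w)) (trit (eta 2 w)).
by rewrite /= !inord_val !trit_valK//; case: gw => // _ /(_ 0%N).
Qed.

Lemma erw_slln : {ae P, forall w, (fun n => erw_Z X1 eta K p q n w / n%:R) @ \oo --> (0 : R)}.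
Proof.
apply: filterS ae_erw_path => w [gw hw].
set x1 := X1 w in hw *; set x2 := eta 2 w * x1 in hw *.
have ZE n := @erw_ZE w n x1 x2 gw erefl erefl.
(* In the degenerate case [X1 = 0] and all centred steps are 0; otherwise the upper half of the
   iterated logarithm for both signs bounds the walk. *)
have [e|e] := eqVneq (x1 ^+ 2 + x2 ^+ 2) 0.
  have x10 : x1 = 0.
    by apply/eqP; rewrite -sqrf_eq0 eq_le sqr_ge0 -e lerDl sqr_ge0.
  apply: (cvg_div_nat_lil (C := 1) _ ZE) => //; exists 0%N => k _.
  rewrite /Sw big1 ?normr0 ?mul1r ?sqrtr_ge0// => l _.
  by rewrite /erw_W /erw_mu /x2 x10; case: ifP => _; ring.
have s0 := sigma_gt0 e.
have [[N1 h1] [N2 h2] _ _] := hw e 0%N.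
apply: (cvg_div_nat_lil (C := sigma_ x1 x2 + 1) _ ZE); first by rewrite addr_gt0.
exists (N1 + N2)%N => k hk; rewrite ler_norml lerNl.
have := h1 k (leq_trans (leq_addr _ _) hk); have := h2 k (leq_trans (leq_addl _ _) hk).
by rewrite invr1 => -> ->.
Qed.

Lemma erw_lil : {ae P, forall w, X1 w ^+ 2 + (eta 2 w * X1 w) ^+ 2 != 0 ->
  limn_esup (fun n => (erw_Z X1 eta K p q n w / lil_norm n)%:E)
    = (erw_sigma p q (X1 w) (eta 2 w * X1 w))%:E /\
  limn_einf (fun n => (erw_Z X1 eta K p q n w / lil_norm n)%:E)
    = (- erw_sigma p q (X1 w) (eta 2 w * X1 w))%:E}.
Proof.
apply: filterS ae_erw_path => w [gw hw] /[dup] e /hw {}hw.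
have s0 := sigma_gt0 e.
have ZE n := @erw_ZE w n _ _ gw erefl erefl.
split.
  by apply: (limn_esup_lil s0 ZE) => m; have [] := hw m.
have ZN n : - erw_Z X1 eta K p q n.+2 w = - shift (X1 w) (eta 2 w * X1 w) +
    - Sw (erw_W (X1 w) (eta 2 w * X1 w)) (word erw_letter n w).
  by rewrite ZE opprD.
(* The lower limit is minus the upper limit of the opposite sequence, to which the facts for [- Sw]
   apply with the same [sigma_]. *)
rewrite EFinN -(limn_esup_lil (Z := fun n => - erw_Z X1 eta K p q n w) s0 ZN).
- by congr (- limn_esup _)%E; apply/funext => n; rewrite mulNr EFinN.
- by move=> m; have [] := hw m.
- by move=> m; have [] := hw m.
Qed.

End erw_letters.

Theorem theorem6p2 (R : realType) (d : measure_display) (T : measurableType d)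
  (P : probability T R) (p q r : R) (X1 : T -> R) (eta K : nat -> T -> R)
  (hp : 0 < p < 1) (hq : 0 < q < 1) (hr : 0 < r < 1) (hpqr : p + q + r = 1)
  (hX1 : P (X1 @^-1` [set 1]) = p%:E /\ P (X1 @^-1` [set -1]) = q%:E /\
         P (X1 @^-1` [set 0]) = r%:E)
  (heta : forall n, (2 <= n)%N ->
         P (eta n @^-1` [set 1]) = p%:E /\ P (eta n @^-1` [set -1]) = q%:E /\
         P (eta n @^-1` [set 0]) = r%:E)
  (hK : forall n, (3 <= n)%N ->
         P (K n @^-1` [set 1]) = (2^-1)%:E /\ P (K n @^-1` [set 2]) = (2^-1)%:E)
  (hind : mutual_indep P (fun i : nat + nat =>
            match i with
            | inl 0 => X1
            | inl n.+1 => eta n.+2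
            | inr n => K n.+3
            end)) :
  let Z := erw_Z X1 eta K p q in
  let X2 := erw_X X1 eta K 2 in
  let s1 := Num.sqrt (p + q - (p - q) ^+ 2) in
  let s2 := Num.sqrt ((p + q) / 2 - ((p - q) / 2) ^+ 2) in
  let s3 := Num.sqrt (p + q) in
  let F := fun x : R => p * (p + q) * Phi (x / s1) + r * (p + q) * Phi (x / s2)
                        + q * (p + q) * Phi (x / s3) + r * (if 0 <= x then 1 else 0) in
  [/\ cvg_in_distribution P (fun n w => Z n w / Num.sqrt n%:R) F,
      {ae P, forall w, (fun n => Z n w / n%:R) @ \oo --> 0}
    & {ae P, forall w, X1 w ^+ 2 + X2 w ^+ 2 != 0 ->
        limn_esup (fun n => (Z n w / Num.sqrt (2 * n%:R * ln (ln n%:R)))%:E)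
          = (erw_sigma p q (X1 w) (X2 w))%:E /\
        limn_einf (fun n => (Z n w / Num.sqrt (2 * n%:R * ln (ln n%:R)))%:E)
          = (- erw_sigma p q (X1 w) (X2 w))%:E}].
Proof.
move=> Z X2 s1 s2 s3 F; split.
- by move=> x _; exact: erw_cvg_in_distribution.
- exact: (erw_slln hp hq hr hpqr hX1 heta hK hind).
- exact: (erw_lil hp hq hr hpqr hX1 heta hK hind).
Qed.
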